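(* Let $(\Omega,T)$ be a dynamical system ($\Omega$ a nonempty compact metrizable space, $T:\Omega\to\Omega$ continuous), let $\Omega\ni\omega\mapsto a(\omega)\in\ell^\infty$ be a map that is continuous for the weak$^*$ topology of $\ell^\infty$ and satisfies $\sigma(a(\omega))=a(T\omega)$ for all $\omega\in\Omega$, and let $0<c<1$. For $\omega\in\Omega$ define $S_\omega:\ell^\infty\to\ell^\infty$ by $S_\omega(x)=cx+a(\omega)$. Let $X\subset\ell^\infty$ be the self-similar system defined by $\{S_\omega\}_{\omega\in\Omega}$, i.e. the unique nonempty weak$^*$-compact subset with $X=\bigcup_{\omega\in\Omega}S_\omega(X)$ (it satisfies $\sigma(X)\subset X$), with the metric $d((x_n)_n,(y_n)_n)=\sum_{n=1}^\infty2^{-n}|x_n-y_n|$. Then the mean Hausdorff dimension and the metric mean dimension of $(X,\sigma,d)$ exist and \[ \mathrm{mdim}_{\mathrm{H}}(X,\sigma,d)=\mathrm{mdim}_{\mathrm{M}}(X,\sigma,d)\le\frac{h_{\mathrm{top}}(\Omega,T)}{\log(1/c)}, \] where $h_{\mathrm{top}}(\Omega,T)$ is the topological entropy of $(\Omega,T)$.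
   Context: $\mathbb{N}=\{1,2,3,\dots\}$. $\ell^\infty$ is the space of bounded real sequences $(x_n)_{n\in\mathbb{N}}$, endowed with the weak$^*$ topology as the dual of $\ell^1$; $\sigma:\ell^\infty\to\ell^\infty$ is the shift $\sigma((x_n)_n)=(x_{n+1})_n$. For a compact metric space $(X,d)$ and $\varepsilon>0$, the covering number $\#(X,d,\varepsilon)$ is the minimum $n$ such that $X$ has an open cover $\{U_1,\dots,U_n\}$ with $\mathrm{Diam}\,U_i<\varepsilon$ for all $i$. Set $\dim_{\mathrm{M}}(X,d,\varepsilon)=\log\#(X,d,\varepsilon)/\log(1/\varepsilon)$. For $s\ge 0$ set $\mathcal{H}^s_\varepsilon(X,d)=\inf\{\sum_{i=1}^\infty(\mathrm{Diam}\,E_i)^s : X=\bigcup_{i=1}^\infty E_i,\ \mathrm{Diam}\,E_i<\varepsilon\ \forall i\}$, with conventions $0^0=1$ and $(\mathrm{Diam}\,\emptyset)^s=0$ for all $s\ge0$. The $\varepsilon$-scale Hausdorff dimension $\dim_{\mathrm{H}}(X,d,\varepsilon)$ is the supremum of $s\ge0$ with $\mathcal{H}^s_\varepsilon(X,d)\ge1$. For a continuous map $T:X\to X$ and $N\ge1$ let $d_N(x,y)=\max_{0\le n<N}d(T^nx,T^ny)$. The topological entropy is $h_{\mathrm{top}}(X,T)=\lim_{\varepsilon\to0}\lim_{N\to\infty}\frac1N\log\#(X,d_N,\varepsilon)$ (independent of the compatible metric $d$). The upper and lower metric mean dimensions of $(X,T,d)$ are the $\limsup$ and $\liminf$ as $\varepsilon\to0$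 of $\lim_{N\to\infty}\dim_{\mathrm{M}}(X,d_N,\varepsilon)/N$; if equal, the common value is $\mathrm{mdim}_{\mathrm{M}}(X,T,d)$. The upper and lower mean Hausdorff dimensions are $\lim_{\varepsilon\to0}\limsup_{N\to\infty}\dim_{\mathrm{H}}(X,d_N,\varepsilon)/N$ and $\lim_{\varepsilon\to0}\liminf_{N\to\infty}\dim_{\mathrm{H}}(X,d_N,\varepsilon)/N$; if equal, the common value is $\mathrm{mdim}_{\mathrm{H}}(X,T,d)$. *)

(* Defs.v *)
From HB Require Import structures.
From mathcomp Require Import all_boot all_order all_algebra.
From mathcomp Require Import all_classical all_reals all_analysis.

Set Implicit Arguments.
Unset Strict Implicit.
Unset Printing Implicit Defensive.

Import Order.TTheory GRing.Theory Num.Theory.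
Import numFieldNormedType.Exports.

Local Open Scope classical_set_scope.
Local Open Scope ring_scope.

(* A metric space (X, d) is a set [X : set T] together with a distance
   [d : T -> T -> R], of which only the values on [X] matter. *)
Section MetricDimensions.
Context {R : realType} {T : Type}.
Implicit Types (d : T -> T -> R) (X U E : set T) (eps s : R).

Definition diam d E : \bar R :=
  if E == set0 then 0%E
  else ereal_sup [set z | exists x y, [/\ E x, E y & z = (d x y)%:E]].

Definition relatively_open d X U : Prop :=
  U `<=` X /\
  forall x, U x -> exists2 r : R, 0 < r & forall y, X y -> d x y < r -> U y.

Definition has_small_cover d X eps (n : nat) : Prop :=
  exists U : 'I_n -> set T,
    [/\ forall i, relatively_open d X (U i),
        forall i, (diam d (U i) < eps%:E)%E
      & X = \bigcup_i U i].

(* The least n admitting such a cover ([get] picks this unique n, which exists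
   as soon as (X, d) is compact and 0 < eps). *)
Definition covering_number d X eps : nat :=
  get [set n | has_small_cover d X eps n /\
               forall m, has_small_cover d X eps m -> (n <= m)%N].

Definition dimM d X eps : R :=
  ln (covering_number d X eps)%:R / ln eps^-1.

(* [poweR] already satisfies 0 `^ 0 = 1. *)
Definition diam_pow d s E : \bar R :=
  if E == set0 then 0%E else poweR (diam d E) s.

Definition hausdorff_content d X eps s : \bar R :=
  ereal_inf [set z | exists E : (set T)^nat,
    [/\ X = \bigcup_i E i, forall i, (diam d (E i) < eps%:E)%E
      & z = (\sum_(0 <= i <oo) diam_pow d s (E i))%E]].

Definition dimH d X eps : \bar R :=
  ereal_sup [set s%:E | s in
    [set s | 0 <= s /\ (1 <= hausdorff_content d X eps s)%E]].

End MetricDimensions.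

(* These notions are meant for X compact, nonempty and mapped into itself by f:
   subadditivity in N and monotonicity in eps then make all the limits taken
   with [lim] exist. *)
Section MeanDimensions.
Context {R : realType} {T : Type}.
Implicit Types (d : T -> T -> R) (f : T -> T) (X : set T) (v : \bar R).

Definition bowen d f (N : nat) (x y : T) : R :=
  \big[Num.max/0]_(0 <= n < N) d (iter n f x) (iter n f y).

Definition htop d f X : \bar R :=
  lim ((limn (fun N : nat =>
          (ln (covering_number (bowen d f N) X eps)%:R / N%:R)%:E : \bar R))
       @[eps --> (0 : R)^'+]).

Definition mdimM_scale d f X (eps : R) : \bar R :=
  limn (fun N : nat => (dimM (bowen d f N) X eps / N%:R)%:E : \bar R).

Definition upper_mdimM d f X : \bar R :=
  limf_esup (mdimM_scale d f X) (0 : R)^'+.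

Definition lower_mdimM d f X : \bar R :=
  limf_einf (mdimM_scale d f X) (0 : R)^'+.

Definition upper_mdimH d f X : \bar R :=
  lim ((limn_esup (fun N : nat =>
          (dimH (bowen d f N) X eps * (N%:R^-1)%:E)%E))
       @[eps --> (0 : R)^'+]).

Definition lower_mdimH d f X : \bar R :=
  lim ((limn_einf (fun N : nat =>
          (dimH (bowen d f N) X eps * (N%:R^-1)%:E)%E))
       @[eps --> (0 : R)^'+]).

Definition is_mdimM d f X v : Prop :=
  upper_mdimM d f X = v /\ lower_mdimM d f X = v.

Definition is_mdimH d f X v : Prop :=
  upper_mdimH d f X = v /\ lower_mdimH d f X = v.

End MeanDimensions.

(* Sequences are indexed from 0: the term x_n (n >= 1) is [x n.-1]. *)
Section SequenceSpaces.
Context (R : realType).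

Definition bounded_seq : {pred nat -> R} :=
  mem [set x : nat -> R | exists M, forall n, `|x n| <= M].

Lemma bounded_seq_submod : submod_closed bounded_seq.
Proof.
split; first by apply/mem_set; exists 0 => n; rewrite normr0.
move=> k u v /set_mem[M uM] /set_mem[M' vM'].
apply/mem_set; exists (`|k| * M + M') => n.
by rewrite (le_trans (ler_normD _ _))// lerD// normrM ler_wpM2l.
Qed.

HB.instance Definition _ :=
  GRing.isSubmodClosed.Build R (nat -> R) bounded_seq bounded_seq_submod.

Record linf : Type := Linf { linf_val :> nat -> R ; _ : linf_val \in bounded_seq }.

HB.instance Definition _ := [isSub for linf_val].
HB.instance Definition _ := [Choice of linf by <:].
HB.instance Definition _ := [SubChoice_isSubLmodule of linf by <:].

Record l1 : Type :=
  L1 { l1_val :> nat -> R ; _ : cvgn (series (fun n => `|l1_val n|)) }.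

Definition pairing (x : linf) (y : l1) : R :=
  limn (series (fun n => x n * y n)).

(* The weak* topology: the coarsest one making [pairing ^~ y] continuous
   for every y in l^1; {ptws _ -> _} carries the product topology. *)
HB.instance Definition _ := Topological.copy linf
  (initial_topology (pairing : linf -> {ptws l1 -> R})).

Lemma linf_shift_subproof (x : linf) : (fun n => x n.+1) \in bounded_seq.
Proof.
case: x => x /= /set_mem[M xM].
by apply/mem_set; exists M => n; exact: xM.
Qed.

Definition linf_shift (x : linf) : linf := Linf (linf_shift_subproof x).

Definition linf_dist (x y : linf) : R :=
  limn (series (fun n => 2 ^- n.+1 * `|x n - y n|)).

End SequenceSpaces.

Definition self_similar_system (R : realType) (Omega : Type)
    (S : Omega -> linf R -> linf R) (X : set (linf R)) : Prop :=
  [/\ X !=set0, compact X & X = \bigcup_w S w @` X].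

(* Main.v *)
Require Import Defs.
From HB Require Import structures.
From mathcomp Require Import all_boot all_order all_algebra.
From mathcomp Require Import all_classical all_reals all_analysis.
From mathcomp Require Import ring lra.

Set Implicit Arguments.
Unset Strict Implicit.
Unset Printing Implicit Defensive.

Import Order.TTheory GRing.Theory Num.Theory.
Import numFieldNormedType.Exports.

Local Open Scope classical_set_scope.
Local Open Scope ring_scope.

(* Openness of covers is irrelevant at a fixed scale, so covering numbers are
   treated as sizes of colourings whose colour classes have small diameter.
   Submultiplicativity in N (Fekete) yields a scale entropy H(e), and always
   lower mdim_H <= upper mdim_H <= lower mdim_M <= upper mdim_M.

   To close the chain, put r = c^m.  A maximal r-separated set for d_N (up to
   constants) has at least exp(N H(r)) points, and each of them lies in a copy
   r X + b of X contained in X.  As d_N scales exactly under x |-> r x + b, these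
   copies are disjoint, and iterating them produces a Cantor set coded by infinite
   words.  Comparing an arbitrary cover with cylinders of the uniform product
   measure bounds the Hausdorff content from below by 1, so H(r) is at most
   m ln(1/c) times the lower mean Hausdorff dimension.

   For the entropy bound, expand x = a(w_1) + ... + c^(n-1) a(w_n) + c^n y:
   a cover of Omega at the scale given by uniform continuity of a, used n times
   with n about ln(1/e) / ln(1/c), colours X at scale e. *)

(** * Covering numbers, colourings and Bowen distances *)

Section Covers.
Context {R : realType} {T : Type}.
Implicit Types (d : T -> T -> R) (f : T -> T) (X : set T).

(** Distinct points may be at distance 0: for [N = 0] the Bowen distance vanishes identically. *)
Definition pseudometric d : Prop :=
  [/\ forall x, d x x = 0, forall x y, d x y = d y x
    & forall x y z, d x z <= d x y + d y z].

Lemma bowen_leP d f N x y (r : R) : 0 <= r ->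
  bowen d f N x y <= r <->
  forall n, (n < N)%N -> d (iter n f x) (iter n f y) <= r.
Proof.
move=> r0; rewrite /bowen big_mkord; split.
  by move=> /bigmax_leP[_ h] n nN; exact: (h (Ordinal nN)).
by move=> h; apply/bigmax_leP; split=> // i _; exact: h.
Qed.

Lemma bowen_ge0 d f N x y : 0 <= bowen d f N x y.
Proof. by rewrite /bowen big_mkord; exact: bigmax_ge_id. Qed.

Lemma le_bowen d f N x y n : (n < N)%N ->
  d (iter n f x) (iter n f y) <= bowen d f N x y.
Proof. by move=> nN; apply: (bowen_leP d f N x y (bowen_ge0 _ _ _ _ _)).1. Qed.

Lemma pseudometric_bowen d f N : pseudometric d -> pseudometric (bowen d f N).
Proof.
move=> [d0 dC dT]; split.
- move=> x; apply/eqP; rewrite eq_le bowen_ge0 andbT.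
  by apply/bowen_leP => // n _; rewrite d0.
- by move=> x y; rewrite /bowen; apply: eq_bigr => i _; rewrite dC.
- move=> x y z; apply/bowen_leP; first by rewrite addr_ge0// bowen_ge0.
  move=> n nN; apply: (le_trans (dT _ (iter n f y) _)).
  by apply: lerD; exact: le_bowen.
Qed.

Lemma iter_stable f X n x : (forall x, X x -> X (f x)) -> X x -> X (iter n f x).
Proof. by move=> fX Xx; elim: n => //= n; exact: fX. Qed.

(* Slightly enlarging its classes makes a colouring an open cover, so openness
   plays no role in covering numbers. *)
Definition coloring d X (eps : R) (I : finType) : Prop :=
  exists (col : T -> I) (r : R), r < eps /\
    forall x y, X x -> X y -> col x = col y -> d x y <= r.

Lemma diam_leP d (E : set T) (r : R) : 0 <= r ->
  (diam d E <= r%:E)%E <-> forall x y, E x -> E y -> d x y <= r.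
Proof.
move=> r0; rewrite /diam; case: eqP => [->|_]; first by split=> // _; rewrite lee_fin.
split=> [h x y Ex Ey|h].
  by rewrite -lee_fin (le_trans _ h)//; apply: ereal_sup_ubound; exists x, y.
by apply: ge_ereal_sup => _ [x [y [Ex Ey ->]]]; rewrite lee_fin; exact: h.
Qed.

Lemma diam_lt d (E : set T) (eps : R) : 0 < eps -> pseudometric d ->
  (diam d E < eps%:E)%E -> exists r : R, [/\ 0 <= r, r < eps & (diam d E = r%:E)%E].
Proof.
move=> e0 dP h.
have d0 : (0%:E <= diam d E)%E.
  rewrite /diam; case: eqP => // /eqP/set0P[x Ex].
  apply: ereal_sup_ubound; exists x, x; split => //.
  by case: dP => ->.
move: h d0; case: (diam d E) => [r| |]//; rewrite lte_fin lee_fin => re r0.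
by exists r.
Qed.

Lemma coloring_small_cover d X eps (I : finType) : pseudometric d -> 0 < eps ->
  coloring d X eps I -> has_small_cover d X eps #|I|.
Proof.
move=> dP e0 [col [r [re colP]]].
have [d0 dC dT] := dP.
pose r' := Num.max 0 r.
have r'e : r' < eps by rewrite gt_max e0.
have r'0 : 0 <= r' by rewrite le_max lexx.
have rr' : r <= r' by rewrite le_max lexx orbT.
(* Thickening a class by [t] adds at most [2 * t] to its diameter, half of the gap between [r'] and
   [eps]. *)
pose t := (eps - r') / 4.
exists (fun i => [set x | X x /\ exists y, [/\ X y, col y = enum_val i & d x y < t]]).
split.
- move=> i; split; first by move=> x [].
  move=> x [Xx [y [Xy yi xy]]].
  exists (t - d x y) => [|z Xz xz]; first by rewrite subr_gt0.
  split=> //; exists y; split=> //; have := dT z x y; rewrite (dC z x); lra.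
- move=> i; apply: (@le_lt_trans _ _ (r' + t + t)%:E); last by rewrite lte_fin /t; lra.
  apply/diam_leP; first by rewrite /t; lra.
  move=> x x' [Xx [y [Xy yi xy]]] [Xx' [y' [Xy' yi' xy']]].
  have := colP _ _ Xy Xy'; rewrite yi yi' => /(_ erefl).
  have := dT x y x'; have := dT y y' x'; rewrite (dC y' x'); lra.
- apply/seteqP; split => [x Xx|x [i _ []]//].
  exists (enum_rank (col x)) => //; split => //; exists x; split => //.
    by rewrite enum_rankK.
  by rewrite d0 /t; lra.
Qed.

Lemma small_cover_coloring d X eps n : pseudometric d -> 0 < eps -> X !=set0 ->
  has_small_cover d X eps n -> coloring d X eps 'I_n.
Proof.
move=> dP e0 [x0 Xx0] [U [_ Ue XU]].
have [i0 _ _] : (\bigcup_i U i) x0 by rewrite -XU.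
have /choice[rho rhoP] : forall i, exists r : R,
    [/\ 0 <= r, r < eps & (diam d (U i) = r%:E)%E].
  by move=> i; exact: diam_lt.
have /choice[col colP] : forall x, exists i, X x -> U i x.
  move=> x; have [Xx|nXx] := pselect (X x); last by exists i0.
  by move: (Xx); rewrite XU => -[i _ Ui]; exists i.
(* Finitely many diameters below [eps] have a maximum below [eps], which is one bound for all
   classes. *)
exists col, (\big[Num.max/0]_i rho i); split.
  by apply/bigmax_ltP; split => // i _; have [] := rhoP i.
move=> x y Xx Xy cxy.
apply: (le_trans _ (le_bigmax _ _ (col x))).
have [r0 _ dr] := rhoP (col x).
have h : (diam d (U (col x)) <= (rho (col x))%:E)%E by rewrite dr.
apply: ((diam_leP _ _ r0).1 h) => //; first exact: colP.
by rewrite cxy; exact: colP.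
Qed.

(** A colouring guarantees that some finite cover exists, so [get] returns the minimal size and not
    a default value. *)
Lemma covering_numberP d X eps (I : finType) : pseudometric d -> 0 < eps ->
  coloring d X eps I ->
  has_small_cover d X eps (covering_number d X eps) /\
  forall m, has_small_cover d X eps m -> (covering_number d X eps <= m)%N.
Proof.
move=> dP e0 /(coloring_small_cover dP e0) cI.
have ex : exists n, `[< has_small_cover d X eps n >] by exists #|I|; apply/asboolP.
case: (ex_minnP ex) => n /asboolP nP nmin.
apply: (@getPex _ [set n | has_small_cover d X eps n /\
               forall m, has_small_cover d X eps m -> (n <= m)%N]).
by exists n; split => // m mP; apply: nmin; apply/asboolP.
Qed.

Lemma covering_number_coloring d X eps (I : finType) : pseudometric d ->
  0 < eps -> X !=set0 -> coloring d X eps I ->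
  coloring d X eps 'I_(covering_number d X eps).
Proof.
by move=> dP e0 X0 /(covering_numberP dP e0)[h _]; exact: small_cover_coloring.
Qed.

Lemma covering_number_le d X eps (I : finType) : pseudometric d -> 0 < eps ->
  coloring d X eps I -> (covering_number d X eps <= #|I|)%N.
Proof.
move=> dP e0 cI; have [_ ->//] := covering_numberP dP e0 cI.
exact: coloring_small_cover.
Qed.

Lemma covering_number_gt0 d X eps (I : finType) : pseudometric d -> 0 < eps ->
  X !=set0 -> coloring d X eps I -> (0 < covering_number d X eps)%N.
Proof.
move=> dP e0 [x Xx] cI; have [col _] := covering_number_coloring dP e0 (ex_intro _ x Xx) cI.
exact: leq_ltn_trans (ltn_ord (col x)).
Qed.

Lemma coloringW d X eps eps' (I : finType) : eps <= eps' ->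
  coloring d X eps I -> coloring d X eps' I.
Proof. by move=> ee' [col [r [re h]]]; exists col, r; split => //; lra. Qed.

Lemma le_covering_number d X eps eps' (I : finType) : pseudometric d ->
  0 < eps -> eps <= eps' -> X !=set0 -> coloring d X eps I ->
  (covering_number d X eps' <= covering_number d X eps)%N.
Proof.
move=> dP e0 ee' X0 cI.
have /(coloringW ee') := covering_number_coloring dP e0 X0 cI.
by move=> /(covering_number_le dP (lt_le_trans e0 ee')); rewrite card_ord.
Qed.

(** * Submultiplicativity of covering numbers in time *)

Section Iterates.
Variables (d : T -> T -> R) (f : T -> T) (X : set T).
Hypothesis dP : pseudometric d.
Hypothesis fX : forall x, X x -> X (f x).

(** The colour of [x] controls the times before [M], that of [iter M f x] the [N] times from [M]
    on. *)
Lemma coloring_bowenD eps M N (I J : finType) :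
  coloring (bowen d f M) X eps I -> coloring (bowen d f N) X eps J ->
  coloring (bowen d f (M + N)) X eps (I * J)%type.
Proof.
move=> [col [r [re colP]]] [col' [r' [re' colP']]].
exists (fun x => (col x, col' (iter M f x))), (Num.max r r'); split.
  by rewrite gt_max re.
move=> x y Xx Xy [cxy cxy'].
have rM := colP _ _ Xx Xy cxy.
have rN := colP' _ _ (iter_stable M fX Xx) (iter_stable M fX Xy) cxy'.
apply/bowen_leP; first by rewrite le_max (le_trans (bowen_ge0 d f M x y) rM).
move=> n nMN; rewrite le_max; have [nM|Mn] := ltnP n M.
  by rewrite (le_trans _ rM)//; exact: le_bowen.
rewrite (le_trans _ rN) ?orbT// -(subnK Mn) !iterD; apply: le_bowen.
by rewrite ltn_subLR.
Qed.

Lemma coloring_bowen eps (I : finType) N : 0 < eps ->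
  coloring d X eps I -> exists J : finType, coloring (bowen d f N) X eps J.
Proof.
move=> e0 cI; elim: N => [|N [J cJ]].
  exists unit, (fun=> tt), 0; split=> // x y _ _ _.
  by rewrite /bowen big_geq.
exists (I * J)%type; rewrite -add1n; apply: coloring_bowenD => //.
have [col [r [re colP]]] := cI.
exists col, (Num.max 0 r); split; first by rewrite gt_max e0.
move=> x y Xx Xy cxy; apply/bowen_leP; first by rewrite le_max lexx.
by move=> [|//] _ /=; rewrite le_max (colP _ _ Xx Xy cxy) orbT.
Qed.

Lemma covering_number_bowenD eps M N (I : finType) : 0 < eps -> X !=set0 ->
  coloring d X eps I ->
  (covering_number (bowen d f (M + N)) X eps <=
   covering_number (bowen d f M) X eps * covering_number (bowen d f N) X eps)%N.
Proof.
move=> e0 X0 cI.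
have [J /(covering_number_coloring (pseudometric_bowen f M dP) e0 X0) cM] :=
  coloring_bowen M e0 cI.
have [K /(covering_number_coloring (pseudometric_bowen f N dP) e0 X0) cN] :=
  coloring_bowen N e0 cI.
have := covering_number_le (pseudometric_bowen f (M + N) dP) e0 (coloring_bowenD cM cN).
by rewrite card_prod !card_ord.
Qed.

End Iterates.
End Covers.

(** * Fekete's lemma and limits as the scale tends to 0 *)

Section Limits.
Context {R : realType}.

Section Fekete.
Variable a : nat -> R.
Hypothesis a_ge0 : forall n, 0 <= a n.
Hypothesis a_subadd : forall m n, a (m + n)%N <= a m + a n.

Lemma subadditive_muln q m r : a (q * m + r)%N <= q%:R * a m + a r.
Proof.
elim: q => [|q IH]; first by rewrite mul0n add0n mul0r add0r.
rewrite mulSn -addnA (le_trans (a_subadd _ _))// -natr1.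
by move: IH; lra.
Qed.

(** The limit is the infimum of [a n / n] over positive [n]: for n = q m + r, subadditivity gives
    a(n) <= q a(m) + a(r), and a(r) stays bounded once m is fixed. *)
Lemma fekete : exists l : R, [/\ 0 <= l, forall n, l * n%:R <= a n
  & (fun n => a n / n%:R) @ \oo --> l].
Proof.
pose S := [set a n / n%:R | n in [set n : nat | (0 < n)%N]].
have S0 : S !=set0 by exists (a 1%N / 1%:R); exists 1%N.
have Sl : lbound S 0 by move=> _ [n _ <-]; rewrite divr_ge0.
have hS : has_inf S by split => //; exists 0.
have infle n : (0 < n)%N -> inf S <= a n / n%:R.
  by move=> n0; apply: ge_inf; [exact: hS.2|exists n].
exists (inf S); split.
- exact: lb_le_inf.
- case=> [|n]; first by rewrite mulr0.
  by rewrite -ler_pdivlMr ?ltr0n// infle.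
apply/cvgrPdist_le => /= e e0.
have [_ [m m0 <-] mlt] : exists2 x, S x & x < inf S + e / 2.
  by apply: inf_adherent => //; lra.
pose B := \sum_(r < m) a r.
near=> n.
have n0 : (0 < n)%N by near: n; exists 1%N.
have nR : 0 < n%:R :> R by rewrite ltr0n.
rewrite distrC ger0_norm ?subr_ge0 ?infle//.
have mR : 0 < m%:R :> R by rewrite ltr0n.
have aB : a (n %% m)%N <= B.
  rewrite /B (bigD1 (Ordinal (ltn_pmod n m0)))//= lerDl.
  by apply: sumr_ge0 => i _; exact: a_ge0.
have := subadditive_muln (n %/ m) m (n %% m); rewrite -divn_eq => an.
have qm : (n %/ m)%:R * a m <= n%:R * (a m / m%:R).
  rewrite mulrCA mulrC ler_wpM2l// ler_pdivlMr// -natrM ler_nat.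
  exact: leq_trunc_div.
have Bn : B <= e / 2 * n%:R.
  rewrite mulrC -ler_pdivrMr; last lra.
  by near: n; exact: nbhs_infty_ger.
have : a n <= n%:R * (a m / m%:R + e / 2) by lra.
rewrite mulrC -ler_pdivrMr//; lra.
Unshelve. all: by end_near.
Qed.

End Fekete.

Local Open Scope ereal_scope.

(** As a supremum over all positive scales, the limit is bounded below by the value at any single
    scale. *)
Lemma nonincreasing_lim_at0 (g : R -> \bar R) :
  (forall e e' : R, (0 < e)%R -> (e <= e')%R -> g e' <= g e) ->
  lim (g x @[x --> (0 : R)^'+]) = ereal_sup [set g x | x in [set x : R | (0 < x)%R]].
Proof.
move=> gm; have := @nonincreasing_at_right_cvge R g 0%R (BInfty _ false) isT.
rewrite (_ : [set` _] = [set x : R | (0 < x)%R]); last first.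
  by apply/seteqP; split => x /=; rewrite in_itv/= andbT.
move=> h; apply/cvg_lim => //; apply: h => x y; rewrite !in_itv/= !andbT => x0 _.
exact: gm.
Qed.

Lemma limf_einf_le_esup (f : R -> \bar R) :
  limf_einf f (0 : R)^'+ <= limf_esup f (0 : R)^'+.
Proof.
rewrite limf_einfE limf_esupE; apply: ge_ereal_sup => _ [V FV <-].
apply: le_ereal_inf_tmp => _ [W FW <-].
have [x [Vx Wx]] := filter_ex (filterI FV FW).
apply: (@le_trans _ _ (f x)).
- by apply: ereal_inf_lbound; exists x.
- by apply: ereal_sup_ubound; exists x.
Qed.

Lemma near0_right (e : R) : (0 < e)%R ->
  \forall x \near (0 : R)^'+, (0 < x < e)%R.
Proof.
move=> e0; near=> x; apply/andP; split.
  by near: x; exact: nbhs_right_gt.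
by near: x; exact: nbhs_right_lt.
Unshelve. all: by end_near.
Qed.

(** For every x below both [e] and [e1], g(e) <= g(x) <= M(x), so g(e) is a lower bound of [M] near
    0. *)
Lemma nonincreasing_lim_le_einf (g M : R -> \bar R) (e1 : R) : (0 < e1)%R ->
  (forall e e' : R, (0 < e)%R -> (e <= e')%R -> g e' <= g e) ->
  (forall e : R, (0 < e < e1)%R -> g e <= M e) ->
  lim (g x @[x --> (0 : R)^'+]) <= limf_einf M (0 : R)^'+.
Proof.
move=> e10 gm gM; rewrite (nonincreasing_lim_at0 gm) limf_einfE.
apply: ge_ereal_sup => _ [e e0 <-].
pose e' := Num.min e e1.
have e'0 : (0 < e')%R by rewrite lt_min e0.
apply: le_trans (ereal_sup_ubound _); last first.
  by exists [set x | (0 < x < e')%R]; [exact: near0_right|reflexivity].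
apply: le_ereal_inf_tmp => _ [x /andP[x0 xe'] <-].
move: xe'; rewrite lt_min => /andP[xe xe1].
by rewrite (le_trans _ (gM x _)) ?x0// gm// ltW.
Qed.

(* The additive error [C] disappears when dividing by [ln e^-1]. *)
Lemma limf_esup_log_le (H : R -> R) (w C e1 : R) :
  (0 < e1)%R -> (0 <= w)%R -> (0 <= C)%R ->
  (forall e : R, (0 < e < e1)%R -> (H e <= w * (ln e^-1 + C))%R) ->
  limf_esup (fun e => (H e / ln e^-1)%:E) (0 : R)^'+ <= w%:E.
Proof.
move=> e10 w0 C0 HC; apply/lee_addgt0Pr => eta eta0.
(* Below [b], [ln x^-1] exceeds [w * C / eta], so the error [w * C] is at most [eta * ln x^-1]. *)
pose b : R := expR (- (w * C / eta + 1)).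
pose e' := Num.min b e1.
have e'0 : (0 < e')%R by rewrite lt_min expR_gt0.
rewrite limf_esupE; apply: le_trans (ereal_inf_lbound _) _.
  by exists [set x | (0 < x < e')%R]; [exact: near0_right|reflexivity].
apply: ge_ereal_sup => _ [x /andP[x0 xe'] <-].
move: xe'; rewrite lt_min => /andP[xb xe1].
rewrite -EFinD lee_fin.
have lnx : (w * C / eta + 1 < ln x^-1)%R.
  rewrite lnV ?posrE// ltrNr -(expRK (- _)%R) ltr_ln ?posrE ?expR_gt0//.
have wC : (0 <= w * C / eta)%R by rewrite divr_ge0 ?mulr_ge0// ltW.
have ln0 : (0 < ln x^-1)%R by lra.
rewrite ler_pdivrMr//; apply: (le_trans (HC x _)); first by rewrite x0.
rewrite mulrDr mulrDl lerD2l.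
have : (w * C / eta <= ln x^-1)%R by lra.
by rewrite ler_pdivrMr// [(_ * eta)%R]mulrC.
Qed.

End Limits.

(** * Growth rate of covering numbers at a fixed scale *)

Section ScaleEntropy.
Context {R : realType} {T : Type}.
Variables (d : T -> T -> R) (f : T -> T) (X : set T).
Hypothesis dP : pseudometric d.
Hypothesis fX : forall x, X x -> X (f x).
Hypothesis X0 : X !=set0.
Hypothesis Xtb : forall e : R, 0 < e -> exists I : finType, coloring d X e I.

(** This one quantity serves both invariants: divided by [ln e^-1] it is the metric mean dimension
    at scale [e], and its supremum over [e] is the topological entropy. *)
Definition scale_entropy (e : R) : R :=
  limn (fun N : nat => ln (covering_number (bowen d f N) X e)%:R / N%:R).

Let K N e := covering_number (bowen d f N) X e.

Lemma bowen_covering_number_gt0 N e : 0 < e -> (0 < K N e)%N.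
Proof.
move=> e0; have [I cI] := Xtb e0; have [J cJ] := coloring_bowen fX N e0 cI.
exact: covering_number_gt0 (pseudometric_bowen _ _ dP) e0 X0 cJ.
Qed.

Lemma scale_entropyP e : 0 < e ->
  [/\ 0 <= scale_entropy e, forall N, scale_entropy e * N%:R <= ln (K N e)%:R
    & (fun N : nat => ln (K N e)%:R / N%:R) @ \oo --> scale_entropy e].
Proof.
move=> e0; have Kgt0 N := bowen_covering_number_gt0 N e0.
have [I cI] := Xtb e0.
have [l [l0 lK lcvg]] : exists l : R, [/\ 0 <= l,
    forall n, l * n%:R <= ln (K n e)%:R
    & (fun n => ln (K n e)%:R / n%:R) @ \oo --> l].
  apply: fekete => [n|m n]; first by rewrite ln_ge0// ler1n.
  rewrite -lnM ?posrE ?ltr0n// -natrM ler_ln ?posrE ?ltr0n ?muln_gt0 ?Kgt0//.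
  by rewrite ler_nat; exact: covering_number_bowenD cI.
by have -> : scale_entropy e = l by apply/cvg_lim.
Qed.

Lemma le_scale_entropy e e' : 0 < e -> e <= e' ->
  scale_entropy e' <= scale_entropy e.
Proof.
move=> e0 ee'; have e'0 := lt_le_trans e0 ee'.
have [_ _ c1] := scale_entropyP e0; have [_ _ c2] := scale_entropyP e'0.
apply: (ler_cvg_to c2 c1); near=> N; rewrite ler_wpM2r ?invr_ge0//.
rewrite ler_ln ?posrE ?ltr0n ?bowen_covering_number_gt0// ler_nat.
have [I cI] := Xtb e0; have [J cJ] := coloring_bowen fX N e0 cI.
exact: le_covering_number (pseudometric_bowen _ _ dP) e0 ee' X0 cJ.
Unshelve. all: by end_near.
Qed.

Lemma mdimM_scaleE e : 0 < e ->
  mdimM_scale d f X e = (scale_entropy e / ln e^-1)%:E.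
Proof.
move=> e0; have [_ _ c] := scale_entropyP e0.
apply/cvg_lim => //; apply: cvg_EFin; first exact: nearW.
rewrite (_ : _ \o _ = fun N => (ln (K N e)%:R / N%:R) / ln e^-1); last first.
  by apply/funext => N; rewrite /= /dimM mulrAC.
exact: cvgMl.
Qed.

Lemma scale_entropy_le_htop e : 0 < e -> ((scale_entropy e)%:E <= htop d f X)%E.
Proof.
move=> e0.
pose g (e : R) : \bar R := limn (fun N : nat =>
          (ln (covering_number (bowen d f N) X e)%:R / N%:R)%:E).
have gE e' : 0 < e' -> g e' = (scale_entropy e')%:E.
  move=> e'0; have [_ _ c] := scale_entropyP e'0.
  by apply/cvg_lim => //; apply: cvg_EFin => //; exact: nearW.
rewrite /htop nonincreasing_lim_at0; last first.
  move=> x y x0 xy; have y0 := lt_le_trans x0 xy.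
  by rewrite -![limn _]/(g _) !gE// lee_fin le_scale_entropy.
by rewrite -gE//; apply: ereal_sup_ubound; exists e.
Qed.

Lemma upper_mdimM_log_le (w C e1 : R) : 0 < e1 -> 0 <= w -> 0 <= C ->
  (forall e, 0 < e < e1 -> scale_entropy e <= w * (ln e^-1 + C)) ->
  (upper_mdimM d f X <= w%:E)%E.
Proof.
move=> e10 w0 C0 h; apply: le_trans (limf_esup_log_le e10 w0 C0 h); rewrite /upper_mdimM.
rewrite !limf_esupE; apply: le_ereal_inf_tmp => _ [V FV <-].
apply: le_trans (ereal_inf_lbound _) _.
  exists (V `&` [set x : R | 0 < x < 1]); last reflexivity.
  by apply: filterI => //; exact: near0_right.
apply: ge_ereal_sup => _ [x [Vx /andP[x0 _]] <-].
by rewrite mdimM_scaleE//; apply: ereal_sup_ubound; exists x.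
Qed.

End ScaleEntropy.

(** * Hausdorff content and dimension at a fixed scale *)

Section HausdorffScale.
Context {R : realType} {T : Type}.
Implicit Types (d : T -> T -> R) (X E : set T).

Lemma diam_pow_ge0 d s E : (0 <= diam_pow d s E)%E.
Proof. by rewrite /diam_pow; case: ifP => // _; exact: poweR_ge0. Qed.

Lemma hausdorff_content_ge d X eps s (z : \bar R) :
  (forall E : (set T)^nat, X = \bigcup_i E i ->
     (forall i, (diam d (E i) < eps%:E)%E) ->
     (z <= \sum_(0 <= i <oo) diam_pow d s (E i))%E) ->
  (z <= hausdorff_content d X eps s)%E.
Proof.
move=> h; apply: le_ereal_inf_tmp => _ [E [XE Ee ->]]; exact: h.
Qed.

Lemma dimH_ge d X eps s : 0 <= s -> (1 <= hausdorff_content d X eps s)%E ->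
  (s%:E <= dimH d X eps)%E.
Proof. by move=> s0 h; apply: ereal_sup_ubound; exists s. Qed.

Lemma le_dimH d X eps eps' : eps <= eps' -> (dimH d X eps' <= dimH d X eps)%E.
Proof.
move=> ee'; apply: le_ereal_sup => _ [s [s0 s1] <-].
exists s => //; split => //; apply: (le_trans s1).
apply: hausdorff_content_ge => E XE Ee.
apply: ereal_inf_lbound; exists E; split => // i.
by rewrite (lt_le_trans (Ee i))// lee_fin.
Qed.

(** At exponent 0 each nonempty piece counts 1, and a cover of a nonempty set has a nonempty
    piece. *)
Lemma dimH_ge0 d X eps : X !=set0 -> (0 <= dimH d X eps)%E.
Proof.
move=> [x Xx]; apply: dimH_ge => //; apply: hausdorff_content_ge => E XE _.
have [i _ Eix] : (\bigcup_i E i) x by rewrite -XE.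
apply: (@le_trans _ _ (\sum_(0 <= i < i.+1) diam_pow d 0 (E i))%E); last first.
  by apply: nneseries_lim_ge => n _ _; exact: diam_pow_ge0.
rewrite big_nat_recr//= -[leLHS]add0e leeD//.
  by apply: sume_ge0 => k _; exact: diam_pow_ge0.
rewrite /diam_pow; case: eqP => [E0|_]; last by rewrite poweRe0.
by move: Eix; rewrite E0.
Qed.

(** The [n] colour classes have diameter below [eps], so a content of at least 1 forces 1 <= n
    eps^s, that is s <= ln n / ln(1/eps). *)
Lemma dimH_le_dimM d X eps (I : finType) : pseudometric d -> X !=set0 ->
  0 < eps -> eps < 1 -> coloring d X eps I ->
  (dimH d X eps <= (dimM d X eps)%:E)%E.
Proof.
move=> dP X0 e0 e1 cI.
have lne : 0 < ln eps^-1 by rewrite ln_gt0// invf_gt1.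
have n0 := covering_number_gt0 dP e0 X0 cI.
have [col [r [re colP]]] := covering_number_coloring dP e0 X0 cI.
rewrite /dimM; set n := covering_number d X eps in n0 col colP *.
apply: ge_ereal_sup => _ [s [s0 s1] <-]; rewrite lee_fin ler_pdivlMr//.
(* The classes are padded to a sequence by empty sets, which contribute 0. *)
pose E (i : nat) : set T := [set x | X x /\ col x = i :> nat].
have E0 i : (n <= i)%N -> E i = set0.
  move=> ni; apply/seteqP; split=> // x [_ xi].
  by move: (ltn_ord (col x)); rewrite xi ltnNge ni.
have Ed i : (diam d (E i) <= (Num.max 0 r)%:E)%E.
  apply/diam_leP; first by rewrite le_max lexx.
  move=> x y [Xx xi] [Xy yi]; rewrite le_max colP ?orbT//.
  by apply/val_inj; rewrite /= xi.
have Ee i : (diam d (E i) < eps%:E)%E.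
  by apply: le_lt_trans (Ed i) _; rewrite lte_fin gt_max e0.
have Epow i : (diam_pow d s (E i) <= (eps `^ s)%:E)%E.
  rewrite /diam_pow; case: ifP => _; first by rewrite lee_fin powR_ge0.
  have [q [q0 qe ->]] := diam_lt e0 dP (Ee i).
  by rewrite poweR_EFin lee_fin ge0_ler_powR// ?nnegrE// ltW.
have : (1 <= (n%:R * eps `^ s)%:E)%E.
  apply: (le_trans s1); apply: le_trans (ereal_inf_lbound _) _.
    exists E; split; [|exact: Ee|reflexivity].
    apply/seteqP; split => [x Xx|x [i _ []]//].
    by exists (col x).
  rewrite (nneseries_split 0 n) => [|k _]; last exact: diam_pow_ge0.
  rewrite add0n eseries0 ?adde0 => [|i ni _]; last first.
    by rewrite /diam_pow E0// eqxx.
  apply: (@le_trans _ _ (\sum_(0 <= k < n) (eps `^ s)%:E)%E).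
    by apply: lee_sum => i _; exact: Epow.
  by rewrite sumEFin lee_fin sumr_const_nat subn0 mulr_natl.
rewrite lee_fin => h.
have := h; rewrite -ler_ln ?posrE ?ltr01 ?mulr_gt0 ?powR_gt0 ?ltr0n//.
rewrite ln1 lnM ?posrE ?powR_gt0 ?ltr0n// ln_powR lnV ?posrE//; lra.
Qed.

End HausdorffScale.

(** * Monotonicity of limits superior and inferior *)

Section LimitInequalities.
Context {R : realType}.
Local Open Scope ereal_scope.

Lemma le_limn_esup (u v : (\bar R)^nat) :
  (\forall n \near \oo, u n <= v n) -> limn_esup u <= limn_esup v.
Proof.
move=> uv; rewrite /limn_esup !limf_esupE; apply: le_ereal_inf_tmp => _ [V FV <-].
apply: le_trans (ereal_inf_lbound _) _.
  exists (V `&` [set n | u n <= v n]); last reflexivity.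
  exact: filterI.
apply: ge_ereal_sup => _ [n [Vn uvn] <-]; apply: (le_trans uvn).
by apply: ereal_sup_ubound; exists n.
Qed.

Lemma le_limn_einf (u v : (\bar R)^nat) :
  (\forall n \near \oo, u n <= v n) -> limn_einf u <= limn_einf v.
Proof.
move=> uv; rewrite /limn_einf leeN2; apply: le_limn_esup.
by apply: filterS uv => n; rewrite leeN2.
Qed.

End LimitInequalities.

(** * The chain of inequalities between mean dimensions *)

Section MeanDimensionChain.
Context {R : realType} {T : Type}.
Variables (d : T -> T -> R) (f : T -> T) (X : set T).
Hypothesis dP : pseudometric d.
Hypothesis fX : forall x, X x -> X (f x).
Hypothesis X0 : X !=set0.
Hypothesis Xtb : forall e : R, 0 < e -> exists I : finType, coloring d X e I.
Local Open Scope ereal_scope.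

Let u (e : R) (N : nat) : \bar R := dimH (bowen d f N) X e * (N%:R^-1)%:E.

Let le_u e e' N : (e <= e')%R -> u e' N <= u e N.
Proof.
by move=> ee'; rewrite /u lee_wpmul2r ?lee_fin ?invr_ge0//; exact: le_dimH.
Qed.

Let einf_u e e' : (0 < e)%R -> (e <= e')%R -> limn_einf (u e') <= limn_einf (u e).
Proof. by move=> _ ee'; apply: le_limn_einf; apply: nearW => N; exact: le_u. Qed.

Let esup_u e e' : (0 < e)%R -> (e <= e')%R -> limn_esup (u e') <= limn_esup (u e).
Proof. by move=> _ ee'; apply: le_limn_esup; apply: nearW => N; exact: le_u. Qed.

Lemma lower_mdimH_le_upper : lower_mdimH d f X <= upper_mdimH d f X.
Proof.
rewrite /lower_mdimH (nonincreasing_lim_at0 einf_u).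
rewrite /upper_mdimH (nonincreasing_lim_at0 esup_u).
apply: ge_ereal_sup => _ [e e0 <-]; apply: (le_trans (limn_einf_sup _)).
by apply: ereal_sup_ubound; exists e.
Qed.

(** The inequality holds for each [N]; the limit in [N] on the metric side exists, so it bounds the
    limit superior on the Hausdorff side, scale by scale. *)
Lemma upper_mdimH_le_lower_mdimM : upper_mdimH d f X <= lower_mdimM d f X.
Proof.
apply: (nonincreasing_lim_le_einf (e1 := 1%R) _ esup_u) => // e /andP[e0 e1].
rewrite mdimM_scaleE//.
have [_ _ c] := scale_entropyP dP fX X0 Xtb e0.
have cv : (fun N => (dimM (bowen d f N) X e / N%:R)%:E) @ \oo -->
    (scale_entropy d f X e / ln e^-1)%:E.
  apply: cvg_EFin; first exact: nearW.
  rewrite (_ : _ \o _ = fun N => ln (covering_number (bowen d f N) X e)%:R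
     / N%:R / ln e^-1)%R; last by apply/funext => N; rewrite /= /dimM mulrAC.
  exact: cvgMl.
have [_ <-] := cvg_limn_einf_sup cv.
apply: le_limn_esup; apply: nearW => N.
rewrite EFinM lee_wpmul2r ?lee_fin ?invr_ge0//.
have [I cI] := Xtb e0; have [J cJ] := coloring_bowen fX N e0 cI.
exact: dimH_le_dimM (pseudometric_bowen _ _ dP) X0 e0 e1 cJ.
Qed.

(** The hypothesis closes the chain into a cycle, so all four quantities coincide. *)
Lemma mean_dimensions_eq : upper_mdimM d f X <= lower_mdimH d f X ->
  is_mdimH d f X (lower_mdimH d f X) /\ is_mdimM d f X (lower_mdimH d f X).
Proof.
move=> h; have h1 := lower_mdimH_le_upper; have h2 := upper_mdimH_le_lower_mdimM.
have h3 : lower_mdimM d f X <= upper_mdimM d f X by exact: limf_einf_le_esup.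
split; split => //; apply/eqP; rewrite eq_le; apply/andP; split => //.
- exact: le_trans h2 (le_trans h3 h).
- exact: le_trans h1 (le_trans h2 h3).
- exact: le_trans h3 h.
- exact: le_trans h1 h2.
Qed.

(** A single scale suffices because the limit over scales is a supremum. *)
Lemma le_lower_mdimH (s e : R) : (0 < e)%R ->
  (forall N, (0 < N)%N -> (N%:R * s)%:E <= dimH (bowen d f N) X e) ->
  s%:E <= lower_mdimH d f X.
Proof.
move=> e0 h; rewrite /lower_mdimH (nonincreasing_lim_at0 einf_u).
apply: (@le_trans _ _ (limn_einf (u e))); last first.
  by apply: ereal_sup_ubound; exists e.
have [<- _] := cvg_limn_einf_sup (@cvg_cst _ s%:E nat \oo _).
apply: le_limn_einf; near=> N.
have N0 : (0 < N)%N by near: N; exists 1%N.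
rewrite /u lee_pdivlMr ?ltr0n// -EFinM mulrC; exact: h.
Unshelve. all: by end_near.
Qed.

Lemma lower_mdimH_ge0 : 0 <= lower_mdimH d f X.
Proof.
by apply: (@le_lower_mdimH 0%R 1%R) => // N _; rewrite mulr0; exact: dimH_ge0.
Qed.

End MeanDimensionChain.

(** * Kraft-type inequality for covers by cylinders *)

Section PrefixCovers.
Context {R : realType} (I : finType) (i0 : I).
Local Notation M := (#|I|%:R : R).

Let M_gt0 : 0 < M.
Proof. by rewrite ltr0n; apply/card_gt0P; exists i0. Qed.

(* Conditional probability, under the uniform product measure on [nat -> I],
   of the cylinder over [v] given the cylinder over [u]. *)
Let cond_prob (u v : seq I) : R :=
  if take (size v) u == take (size u) v then M ^- (size v - size u) else 0.

Let cond_prob_ge0 u v : 0 <= cond_prob u v.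
Proof. by rewrite /cond_prob; case: ifP => // _; rewrite invr_ge0 exprn_ge0. Qed.

(** If [v] is incompatible with [u], the left side is 0. If [v] is a prefix of [u], each letter
    contributes at most 1. Otherwise only the letter that [v] prescribes next contributes. *)
Let cond_prob_rcons u v : \sum_(a : I) cond_prob (rcons u a) v <= M * cond_prob u v.
Proof.
have compat a : take (size v) (rcons u a) == take (size (rcons u a)) v ->
    take (size v) u == take (size u) v.
  rewrite size_rcons => /eqP/(congr1 (take (size u))).
  by rewrite takeC -{1}cats1 take_size_cat// => ->; rewrite take_takel.
have [uv|nuv] := boolP (take (size v) u == take (size u) v); last first.
  rewrite big1 ?mulr_ge0// => a _; rewrite /cond_prob ifN//.
  by apply: contra nuv; exact: compat.
have [vu|uv'] := leqP (size v) (size u).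
  rewrite /cond_prob uv (eqP (_ : size v - size u == 0)%N) ?subn_eq0//.
  rewrite expr0 invr1 mulr1.
  apply: (@le_trans _ _ (\sum_(a : I) 1)); last first.
    by rewrite sumr_const.
  apply: ler_sum => a _; case: ifP => // _.
  rewrite size_rcons (eqP (_ : size v - (size u).+1 == 0)%N) ?expr0 ?invr1//.
  by rewrite subn_eq0 leqW.
pose b := nth i0 v (size u).
rewrite (bigD1 b)//= big1 ?addr0 => [|a ab]; last first.
  rewrite /cond_prob ifN//; apply: contra ab => /eqP.
  rewrite size_rcons => /(congr1 (nth i0 ^~ (size u))).
  by rewrite !nth_take// nth_rcons ltnn eqxx => ->.
rewrite {2}/cond_prob uv /cond_prob size_rcons; case: ifP => _; last first.
  by rewrite mulr_ge0// invr_ge0 exprn_ge0.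
by rewrite -(subnSK uv') exprS invfM mulrA divff ?mul1r// gt_eqF.
Qed.

Local Open Scope ereal_scope.

(* If the sum were [< 1], one could follow letters along which the conditional
   sum stays [< 1]; the resulting infinite word avoids every cylinder. *)
Lemma prefix_cover_sum_ge1 (v : nat -> seq I) :
  (forall w : nat -> I, exists n, v n = mkseq w (size (v n))) ->
  1 <= \sum_(0 <= n <oo) (M ^- size (v n))%:E.
Proof.
move=> vP; pose Phi u := \sum_(0 <= n <oo) (cond_prob u (v n))%:E.
have -> : \sum_(0 <= n <oo) (M ^- size (v n))%:E = Phi [::].
  by apply: eq_eseriesr => n _; rewrite /cond_prob/= take0 eqxx subn0.
rewrite leNgt; apply/negP => Phi1.
have /choice[next nextP] u : exists a, Phi u < 1 -> Phi (rcons u a) < 1.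
  have [ua|] := pselect (exists a, Phi (rcons u a) < 1).
    by case: ua => a; exists a.
  (* If every extension had sum at least 1, adding over the letters would give [M <= M * Phi u]. *)
  move=> /forallNP nua; exists i0 => Phiu; exfalso.
  suff : M%:E <= M%:E * Phi u.
    by rewrite -{1}(mule1 M%:E) lee_pmul2l// leNgt Phiu.
  rewrite /Phi -nneseriesZl => [|n _]; last by rewrite lee_fin.
  apply: (@le_trans _ _ (\sum_(a : I) Phi (rcons u a))).
    rewrite [leLHS](_ : _ = \sum_(a : I) 1); last first.
      by rewrite sumEFin sumr_const.
    by apply: lee_sum => a _; rewrite leNgt; apply/negP/nua.
  rewrite /Phi -nneseries_sum => [|a n _]; last by rewrite lee_fin.
  apply: lee_nneseries => [n _ _|n _].
    by apply: sume_ge0 => a _; rewrite lee_fin.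
  by rewrite sumEFin -EFinM lee_fin.
pose p := fix p n := if n is n'.+1 then rcons (p n') (next (p n')) else [::].
have Phip n : Phi (p n) < 1 by elim: n => //= n; exact: nextP.
have pE n : p n = mkseq (next \o p) n by elim: n => // n IH; rewrite mkseqS -IH.
have [n vn] := vP (next \o p).
(* The prefix of this length is [v n] itself, so the [n]-th term alone equals 1. *)
have := Phip (size (v n)); rewrite ltNge => /negP; apply.
apply: (@le_trans _ _ (\sum_(0 <= k < n.+1) (cond_prob (p (size (v n))) (v k))%:E)).
  rewrite big_nat_recr//= {2}pE -vn {2}/cond_prob eqxx subnn expr0 invr1.
  by rewrite leeDr// sume_ge0// => k _; rewrite lee_fin.
by apply: nneseries_lim_ge => k _ _; rewrite lee_fin.
Qed.

End PrefixCovers.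

(** * Coordinates in the weak* topology *)

Section LinfTopology.
Context {R : realType}.
Implicit Types (x y : linf R) (X : set (linf R)).

Lemma cvg_series_single (u : R^nat) n : (forall i, i != n -> u i = 0) ->
  series u @ \oo --> u n.
Proof.
move=> u0; apply: cvg_near_cst; exists n.+1 => // k /= nk.
by rewrite /series/= (bigD1_seq n) ?iota_uniq ?mem_index_iota//= big1 ?addr0.
Qed.

Lemma unit_vector_summable n : cvgn (series (fun k => `|(k == n)%:R : R|)).
Proof.
apply/cvg_ex; exists `|(n == n)%:R|.
apply: (@cvg_series_single (fun k => `|(k == n)%:R|)) => i /negbTE ->.
by rewrite normr0.
Qed.

Definition unit_vector n : l1 R := L1 (@unit_vector_summable n).

Lemma pairing_unit_vector x n : pairing x (unit_vector n) = x n.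
Proof.
apply/cvg_lim => //; have := @cvg_series_single (fun k => x k * unit_vector n k) n.
by rewrite /= eqxx mulr1; apply => i /negbTE ->; rewrite mulr0.
Qed.

(** A coordinate is the pairing with a unit vector of l^1, one of the functionals that define the
    topology. *)
Lemma coord_continuous n : continuous (fun x : linf R => x n).
Proof.
move=> x.
rewrite [X in continuous_at _ X](_ : _ =
    (fun h : l1 R -> R => h (unit_vector n)) \o pairing (R:=R)); last first.
  by apply/funext => y /=; rewrite pairing_unit_vector.
apply: (@continuous_comp _ {ptws l1 R -> R} _
  (pairing (R:=R) : linf R -> {ptws l1 R -> R})).
  exact: (@initial_continuous (linf R) {ptws l1 R -> R} (pairing (R:=R)) x).
exact: (@proj_continuous {classic (l1 R)} (fun=> R) (unit_vector n)).
Qed.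

Lemma compact_coord_bounded X n : compact X ->
  exists B : R, forall x, X x -> `|x n| <= B.
Proof.
move=> Xc; have /compact_bounded[B [_ BP]] : compact [set x n | x in X].
  apply: continuous_compact => //.
  by apply: continuous_subspaceT => x; exact: coord_continuous.
exists (B + 1) => x Xx; apply: BP; first by rewrite ltrDl.
by exists x.
Qed.

(** Compactness yields a cluster point in [X], and continuity of the coordinates forces its
    coordinates to be the limits. *)
Lemma compact_coord_limit X (y : nat -> linf R) (l : nat -> R) : compact X ->
  (forall k, X (y k)) -> (forall n, (fun k => y k n) @ \oo --> l n) ->
  exists2 x, X x & forall n, x n = l n.
Proof.
move=> Xc Xy yl; have FX : (y @ \oo) X by apply: (@nearW _ \oo (fun k => X (y k))).
have [x [Xx xF]] := Xc (y @ \oo) (fmap_proper_filter _ _) FX.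
exists x => // n; apply: contrapT => xl.
pose e := `|x n - l n| / 2.
have e0 : 0 < e by rewrite divr_gt0// normr_gt0 subr_eq0; apply/eqP.
have A1 : (y @ \oo) [set z : linf R | `|l n - z n| < e].
  by have /cvgrPdist_lt := yl n; apply.
have B1 : nbhs x [set z : linf R | `|x n - z n| < e].
  by have /cvgrPdist_lt := @coord_continuous n x; apply.
have [z [/= z1 z2]] := xF _ _ A1 B1.
have := ler_normB (x n - z n) (l n - z n).
rewrite opprB addrA subrK [`|x n - l n|](_ : _ = e + e); last by rewrite /e -splitr.
lra.
Qed.

End LinfTopology.

(** * The weighted distance on bounded sequences and its scaling *)

Section LinfDist.
Context {R : realType}.
Implicit Types (x y z b : linf R) (r eta C : R).
Local Notation d := (@linf_dist R).

Lemma linf_scaleD r x b n : (r *: x + b) n = r * x n + b n.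
Proof. by []. Qed.

Lemma iter_linf_shift k x n : iter k (@linf_shift R) x n = x (k + n)%N.
Proof. by elim: k n => //= k IH n; rewrite IH addnS. Qed.

Lemma linf_eq x y : (forall n, x n = y n) -> x = y.
Proof. by move=> h; apply: val_inj; apply/funext. Qed.

Let term x y n : R := 2 ^- n.+1 * `|x n - y n|.

Let term_ge0 x y n : 0 <= term x y n.
Proof. by rewrite mulr_ge0// invr_ge0 exprn_ge0. Qed.

(** The weights sum to 1, and to 2^-L beyond the first [L] indices. *)
Let partial_sum_le x y L eta C k : 0 <= eta -> 0 <= C ->
  (forall n, (n < L)%N -> `|x n - y n| <= eta) ->
  (forall n, `|x n - y n| <= C) ->
  series (term x y) k <= eta + C * 2 ^- L.
Proof.
move=> eta0 C0 xyL xyC.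
have p0 m : 0 < 2 ^- m :> R by rewrite invr_gt0 exprn_gt0.
have pS m : 2 ^- m = 2 * 2 ^- m.+1 :> R.
  by rewrite exprS invfM mulrA divff// mul1r.
(* Keeping the exact geometric partial sums makes the bound inductive in [k]. *)
suff : series (term x y) k <= eta * (1 - 2 ^- k) +
    if (L <= k)%N then C * (2 ^- L - 2 ^- k) else 0.
  move=> /le_trans; apply; apply: lerD.
    by have := mulr_ge0 eta0 (ltW (p0 k)); lra.
  case: ifP => _; last by rewrite mulr_ge0// ltW.
  by have := mulr_ge0 C0 (ltW (p0 k)); lra.
elim: k => [|k IH].
  rewrite /series/= big_geq// expr0 invr1 subrr mulr0 add0r.
  by rewrite leqn0; case: eqP => // ->; rewrite expr0 invr1 subrr mulr0.
rewrite /series/= big_nat_recr//= -[X in X + _]/(series (term x y) k).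
rewrite [term x y k]/term.
have pk := p0 k.+1; move: IH; rewrite (pS k); case: (leqP L k) => Lk IH.
  rewrite (leqW Lk).
  have := ler_wpM2l (ltW pk) (xyC k); have := mulr_ge0 eta0 (ltW pk); lra.
have tk := ler_wpM2l (ltW pk) (xyL k Lk).
have [Lk1|//] := leqP L k.+1; last by lra.
have -> : L = k.+1 by apply/eqP; rewrite eqn_leq Lk1 Lk.
by rewrite subrr mulr0; lra.
Qed.

Lemma linf_bounded_sub x y : exists2 C, 0 <= C & forall n, `|x n - y n| <= C.
Proof.
case: x y => x /= /set_mem[M xM] [y /= /set_mem[M' yM']].
exists (M + M').
  by apply: addr_ge0; [apply: le_trans (xM 0%N)|apply: le_trans (yM' 0%N)].
by move=> n; rewrite (le_trans (ler_normB _ _))// lerD.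
Qed.

Lemma linf_dist_cvg x y : series (term x y) @ \oo --> d x y.
Proof.
have [C C0 xyC] := linf_bounded_sub x y.
apply/cvg_ex; exists (sup (range (series (term x y)))).
apply: nondecreasing_cvgn.
  by apply: nondecreasing_series => n _ _; exact: term_ge0.
exists (0 + C * 2 ^- 0) => _ [k _ <-].
exact: partial_sum_le.
Qed.

Lemma linf_dist_le x y L eta C : 0 <= eta -> 0 <= C ->
  (forall n, (n < L)%N -> `|x n - y n| <= eta) ->
  (forall n, `|x n - y n| <= C) ->
  d x y <= eta + C * 2 ^- L.
Proof.
move=> eta0 C0 xyL xyC; apply: limr_le.
  by apply/cvg_ex; eexists; exact: linf_dist_cvg.
by apply: nearW => k; exact: partial_sum_le.
Qed.

(** General [r] gives scaling; the values 1 and 0 give translation invariance, symmetry and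
    [d x x = 0]. *)
Lemma linf_dist_homo r x y x' y' :
  (forall n, `|x n - y n| = r * `|x' n - y' n|) -> d x y = r * d x' y'.
Proof.
move=> h; apply/cvg_lim => //.
rewrite (_ : series _ = fun k => r * series (term x' y') k).
  by apply: cvgMr; exact: linf_dist_cvg.
apply/funext => k; rewrite /series/= mulr_sumr; apply: eq_bigr => i _.
by rewrite h /term mulrCA.
Qed.

Lemma linf_dist_scaleD r x y b : 0 <= r -> d (r *: x + b) (r *: y + b) = r * d x y.
Proof.
move=> r0; apply: linf_dist_homo => n; rewrite !linf_scaleD.
by rewrite opprD addrACA subrr addr0 -mulrBr normrM ger0_norm.
Qed.

Lemma linf_dist_addl x b b' : d (x + b) (x + b') = d b b'.
Proof.
rewrite -[RHS]mul1r; apply: linf_dist_homo => n.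
rewrite mul1r; congr `|_|.
by rewrite -[(x + b) n]/(x n + b n) -[(x + b') n]/(x n + b' n); lra.
Qed.

Lemma linf_dist_pseudometric : pseudometric d.
Proof.
split.
- move=> x; rewrite (@linf_dist_homo 0 x x x x) ?mul0r// => n.
  by rewrite subrr normr0 mul0r.
- move=> x y; rewrite -[RHS]mul1r; apply: linf_dist_homo => n.
  by rewrite mul1r distrC.
- move=> x y z.
  apply: (ler_cvg_to (linf_dist_cvg (x:=x) (y:=z))
    (cvgD (linf_dist_cvg (x:=x) (y:=y)) (linf_dist_cvg (x:=y) (y:=z)))).
  apply: nearW => k.
  rewrite [leRHS](_ : _ = series (term x y) k + series (term y z) k)//.
  rewrite /series/= -big_split/=; apply: ler_sum => i _.
  rewrite /term -mulrDr ler_wpM2l// ?invr_ge0 ?exprn_ge0//.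
  by rewrite (le_trans _ (ler_normD _ _))// addrA subrK.
Qed.

Lemma iter_linf_shift_scaleD k r x b :
  iter k (@linf_shift R) (r *: x + b) =
  r *: iter k (@linf_shift R) x + iter k (@linf_shift R) b.
Proof.
by apply: linf_eq => n; rewrite !(iter_linf_shift, linf_scaleD).
Qed.

Section BowenLinf.
Variable N : nat.
Local Notation dN := (bowen d (@linf_shift R) N).

Lemma bowen_linf_pseudometric : pseudometric dN.
Proof. exact: pseudometric_bowen linf_dist_pseudometric. Qed.

(** The shift is linear, so [r] factors out of every term of the maximum. The scaling is thus exact
    at every time [N]. *)
Lemma bowen_linf_scaleD r x y b : 0 <= r ->
  dN (r *: x + b) (r *: y + b) = r * dN x y.
Proof.
move=> r0; rewrite /bowen.
rewrite (big_morph (fun t : R => r * t) (id1 := 0) (op1 := Num.max)) ?mulr0//.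
  by apply: eq_bigr => i _; rewrite !iter_linf_shift_scaleD linf_dist_scaleD.
by move=> u v; rewrite maxr_pMr.
Qed.

Lemma bowen_linf_scaleD_le r x y b b' : 0 <= r ->
  dN (r *: x + b) (r *: y + b') <= r * dN x y + dN b b'.
Proof.
move=> r0; have [_ _ tri] := bowen_linf_pseudometric.
apply: (le_trans (tri _ (r *: y + b) _)); rewrite bowen_linf_scaleD// lerD2l.
rewrite le_eqVlt; apply/orP; left; apply/eqP; apply: eq_bigr => i _.
by rewrite !iter_linf_shift_scaleD linf_dist_addl.
Qed.

Lemma bowen_linf_le x y B : (forall n, `|x n| <= B) -> (forall n, `|y n| <= B) ->
  dN x y <= B + B.
Proof.
move=> xB yB; have B0 : 0 <= B := le_trans (normr_ge0 _) (xB 0%N).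
apply/bowen_leP; first exact: addr_ge0.
(* The distance estimate is used with [L = 0] and [eta = 0]: all coordinates count as tail. *)
move=> n _; rewrite -[leRHS]add0r -[B + B]mulr1 -[X in _ * X]invr1 -(expr0 2).
apply: linf_dist_le => //; first exact: addr_ge0.
by move=> k; rewrite !iter_linf_shift (le_trans (ler_normB _ _))// lerD.
Qed.

End BowenLinf.
End LinfDist.

(** * Coding points of [X] by infinite words *)

Section Coding.
Context {R : realType} {I : Type}.
Variables (X : set (linf R)) (B r : R) (b : I -> linf R).
Hypothesis X0 : X !=set0.
Hypothesis Xc : compact X.
Hypothesis XB : forall x n, X x -> `|x n| <= B.
Hypothesis r0 : 0 <= r.
Hypothesis r1 : r < 1.
Hypothesis bX : forall i x, X x -> X (r *: x + b i).

(* Writing [F i x = r *: x + b i], the point [q w] is the limit of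
   [F (w 0) (F (w 1) (... (F (w k) x0)))]. *)
Lemma coding_map : exists q : (nat -> I) -> linf R,
  forall w, X (q w) /\ q w = r *: q (w \o S) + b (w 0%N).
Proof.
have [x0 Xx0] := X0.
pose p := fix p k (w : nat -> I) :=
  if k is k'.+1 then r *: p k' (w \o S) + b (w 0%N) else x0.
have Xp k w : X (p k w) by elim: k w => //= k IH w; exact: bX.
(* The [k] outer maps are common to both points and contract a difference of at most [B + B] by
   [r ^+ k]. *)
have pcauchy k w n : `|p k.+1 w n - p k w n| <= (B + B) * r ^+ k.
  elim: k w => [|k IH] w.
    rewrite expr0 mulr1 (le_trans (ler_normB _ _))//.
    by apply: lerD; apply: XB; [exact: (Xp 1%N w)|exact: (Xp 0%N w)].
  rewrite -[p k.+2 w]/(r *: p k.+1 (w \o S) + b (w 0%N)).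
  rewrite -[p k.+1 w]/(r *: p k (w \o S) + b (w 0%N)) !linf_scaleD.
  rewrite opprD addrACA subrr addr0 -mulrBr normrM ger0_norm// exprS mulrCA.
  by apply: ler_wpM2l => //; exact: IH.
have pcvg w n : cvgn (fun k => p k w n).
  rewrite (_ : (fun k => _) =
      (fun k => p 0%N w n + series (telescope (fun k => p k w n)) k)); last first.
    by apply/funext => k; exact: (eq_sum_telescope (fun k => p k w n)).
  apply: is_cvgD; first exact: is_cvg_cst.
  apply: normed_cvg; apply: (@series_le_cvg _ _ (geometric (B + B) r)) => //.
  - by move=> k; exact: normr_ge0.
  - move=> k /=; apply: mulr_ge0; last exact: exprn_ge0.
    by have := le_trans (normr_ge0 _) (XB 0%N Xx0); lra.
  - move=> k; exact: pcauchy.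
  - by apply: is_cvg_geometric_series; rewrite ger0_norm.
have /choice[q qP] w : exists x, X x /\ forall n, x n = limn (fun k => p k w n).
  have [x Xx xE] := @compact_coord_limit _ X (fun k => p k w)
    (fun n => limn (fun k => p k w n)) Xc (fun k => Xp k w) (pcvg w).
  by exists x.
exists q => w; split; first by have [] := qP w.
apply: linf_eq => n; rewrite linf_scaleD !(qP _).2.
apply/cvg_lim => //; rewrite -cvg_shiftS.
apply: (@cvg_trans _ ((fun k => r * p k (w \o S) n + b (w 0%N) n) @ \oo)) => //.
by apply: cvgD; [apply: cvgMr; exact: pcvg|exact: cvg_cst].
Qed.

End Coding.

(** * Boundedness, shift invariance and pieces of the self-similar system *)

Section SelfSimilarSystem.
Context {R : realType} {Omega : metricType R}.
Variables (T : Omega -> Omega) (a : Omega -> linf R) (c : R) (X : set (linf R)).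
Hypothesis Omega_compact : compact [set: Omega].
Hypothesis a_continuous : continuous a.
Hypothesis a_equivariant : forall w, linf_shift (a w) = a (T w).
Hypothesis c_gt0 : 0 < c.
Hypothesis c_lt1 : c < 1.
Hypothesis X_self_similar :
  self_similar_system (fun w (x : linf R) => c *: x + a w) X.

Lemma iter_shift_equivariant n w : iter n (@linf_shift R) (a w) = a (iter n T w).
Proof. by elim: n => //= n ->. Qed.

Lemma coord_map_continuous n : continuous (fun w => a w n).
Proof.
move=> w; apply: (@continuous_comp _ _ _ a (fun x : linf R => x n)).
  exact: a_continuous.
exact: coord_continuous.
Qed.

(** By equivariance, coordinate [n] of [a w] is coordinate 0 of [a (iter n T w)], and coordinate 0
    is bounded on the compact range of [a]. *)
Lemma translation_bounded : exists A : R, forall w n, `|a w n| <= A.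
Proof.
have /(compact_coord_bounded 0)[A AP] : compact (range a).
  apply: continuous_compact => //.
  by apply: continuous_subspaceT => w; exact: a_continuous.
exists A => w n; rewrite -[n]addn0 -iter_linf_shift iter_shift_equivariant.
by apply: AP; exists (iter n T w).
Qed.

Lemma self_similar_mem w x : X x -> X (c *: x + a w).
Proof.
have [_ _ XE] := X_self_similar; rewrite {2}XE => Xx.
by exists w => //; exists x.
Qed.

Lemma self_similar_pre x : X x -> exists w y, X y /\ x = c *: y + a w.
Proof.
have [_ _ XE] := X_self_similar; rewrite {1}XE => -[w _ [y Xy <-]].
by exists w, y.
Qed.

(** The supremum s of the absolute values of the [n]-th coordinates is finite by compactness and
    satisfies s <= c s + A, whence a bound uniform in [n]. *)
Lemma self_similar_bounded : exists B : R, forall x n, X x -> `|x n| <= B.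
Proof.
have [[x0 Xx0] Xc _] := X_self_similar; have [A AP] := translation_bounded.
exists (A / (1 - c)) => x n Xx.
pose S := [set `|y n| | y in X].
have hS : has_sup S.
  split; first by exists `|x0 n|, x0.
  by have [B BP] := compact_coord_bounded n Xc; exists B => _ [y Xy <-]; exact: BP.
have leS y : X y -> `|y n| <= sup S.
  by move=> Xy; apply: ub_le_sup; [exact: hS.2|exists y].
have : sup S <= c * sup S + A.
  apply: sup_le_ub; first exact: hS.1.
  move=> _ [y Xy <-]; have [w [z [Xz ->]]] := self_similar_pre Xy.
  rewrite linf_scaleD (le_trans (ler_normD _ _))// lerD// normrM gtr0_norm//.
  by rewrite ler_pM2l// leS.
move=> h; apply: (le_trans (leS _ Xx)); rewrite ler_pdivlMr ?subr_gt0//; lra.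
Qed.

(** The shift turns the map of [w] into that of [T w]. Unfolding [x] [k] times therefore puts its
    shift within 2 B c^k of a point of [X] in every coordinate, and [X] contains coordinatewise
    limits. *)
Lemma self_similar_shift x : X x -> X (linf_shift x).
Proof.
have [[x0 Xx0] Xc _] := X_self_similar; have [B BP] := self_similar_bounded.
move=> Xx.
have approx k : forall x, X x ->
    exists2 z, X z & forall n, `|z n - x n.+1| <= (B + B) * c ^+ k.
  elim: k => [|k IH] {Xx}x Xx.
    exists x0 => // n; rewrite expr0 mulr1 (le_trans (ler_normB _ _))//.
    by rewrite lerD// BP.
  have [w [y [Xy ->]]] := self_similar_pre Xx; have [z Xz zy] := IH y Xy.
  exists (c *: z + a (T w)); first exact: self_similar_mem.
  move=> n; rewrite !linf_scaleD -a_equivariant -[linf_shift _ n]/(a w n.+1).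
  rewrite opprD addrACA subrr addr0 -mulrBr normrM gtr0_norm// exprS mulrCA.
  by rewrite ler_pM2l.
have /choice[z zP] k : exists z, X z /\ forall n, `|z n - x n.+1| <= (B + B) * c ^+ k.
  by have [z Xz zx] := approx k x Xx; exists z.
have [y Xy yE] : exists2 y, X y & forall n, y n = x n.+1.
  apply: (@compact_coord_limit _ X z) => //; first by move=> k; have [] := zP k.
  move=> n; apply/cvgrPdist_le => e e0.
  have cvg0 : (fun k => (B + B) * c ^+ k) @ \oo --> 0.
    rewrite -[X in _ --> X](mulr0 (B + B)); apply: cvgMr; apply: cvg_expr.
    by rewrite gtr0_norm.
  move/cvgrPdist_le : cvg0 => /(_ e e0); apply: filterS => k /=.
  rewrite sub0r normrN distrC => h; apply: (le_trans ((zP k).2 n)).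
  exact: le_trans (ler_norm _) h.
by rewrite (_ : linf_shift x = y)//; apply: linf_eq => n; rewrite yE.
Qed.

(** Unfold [x] [m] times: [b] collects the translations met on the way, and the same composite of
    [m] maps sends all of [X] into [X]. *)
Lemma self_similar_piece m x : X x -> exists b,
  (exists2 y, X y & x = c ^+ m *: y + b) /\
  forall z, X z -> X (c ^+ m *: z + b).
Proof.
elim: m x => [|m IH] x Xx.
  exists 0; split=> [|z Xz]; last by rewrite expr0 scale1r addr0.
  by exists x => //; rewrite expr0 scale1r addr0.
have [w [y [Xy ->]]] := self_similar_pre Xx; have [b [[z Xz ->] bX]] := IH y Xy.
exists (c *: b + a w); split.
  by exists z => //; rewrite scalerDr scalerA -exprS addrA.
move=> u Xu; rewrite addrA exprS -scalerA -scalerDr.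
by apply: self_similar_mem; exact: bX.
Qed.

End SelfSimilarSystem.

(** * Separated sets and covering numbers *)

Section Separation.
Context {R : realType} {T : Type}.
Variables (d : T -> T -> R) (X : set T).
Hypothesis dP : pseudometric d.

(** Separated points have distinct colours, which bounds their number. For a maximal family every
    point of [X] is within [e] of some [x i], and colouring by such an index gives classes of
    diameter at most [2 * e]. *)
Lemma maximal_separated (e : R) (J : finType) : 0 < e -> X !=set0 ->
  coloring d X e J ->
  exists n (x : 'I_n -> T), [/\ forall i, X (x i),
    forall i j, i != j -> e <= d (x i) (x j)
    & (covering_number d X (3 * e) <= n)%N].
Proof.
move=> e0 [y0 Xy0] [col [r [re colP]]].
have [d0 dC dT] := dP.
pose sep n := exists x : 'I_n -> T,
  (forall i, X (x i)) /\ forall i j, i != j -> e <= d (x i) (x j).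
have sepJ n : `[< sep n >] -> (n <= #|J|)%N.
  move=> /asboolP[x [Xx xP]]; rewrite -[n]card_ord.
  apply: (@leq_card _ _ (col \o x)) => i j /= cij; apply/eqP.
  apply: contraT => /xP; rewrite leNgt.
  by rewrite (le_lt_trans (colP _ _ (Xx i) (Xx j) cij)).
have ex : exists n, `[< sep n >].
  by exists 0%N; apply/asboolP; exists (fun=> y0); split => [[]|[]].
case: (ex_maxnP ex sepJ) => n /asboolP[x [Xx xP]] nmax.
exists n, x; split => //.
have near_x y : X y -> exists i, d y (x i) < e.
  move=> Xy; apply: contrapT => /forallNP ny.
  have : sep n.+1.
    exists (fun k => if unlift ord_max k is Some i then x i else y); split.
      by move=> k; case: unliftP.
    move=> k l; case: (unliftP ord_max k) => [i ->|->];
      case: (unliftP ord_max l) => [j ->|->] //.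
    - by rewrite (inj_eq (@lift_inj _ _)); exact: xP.
    - by move=> _; rewrite dC leNgt; apply/negP; exact: ny.
    - by move=> _; rewrite leNgt; apply/negP; exact: ny.
    - by rewrite eqxx.
  by move=> /asboolP/nmax; rewrite ltnn.
have [i0 _] := near_x _ Xy0.
have /choice[cy cyP] y : exists i, X y -> d y (x i) < e.
  have [/near_x[i yi]|nXy] := pselect (X y); first by exists i.
  by exists i0.
rewrite -[n]card_ord; apply: covering_number_le => //; first lra.
exists cy, (2 * e); split; first lra.
move=> y z Xy Xz yz; have := cyP _ Xy; have := cyP _ Xz.
by rewrite -yz; have := dT y (x (cy y)) z; rewrite (dC (x (cy y)) z); lra.
Qed.

End Separation.

(** * Lower bound on the Hausdorff content *)

Section HausdorffLowerBound.
Context {R : realType}.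
Variables (X : set (linf R)) (B r : R) (N : nat) (I : finType)
  (x : I -> linf R).
Hypothesis Xc : compact X.
Hypothesis XB : forall x n, X x -> `|x n| <= B.
Hypothesis r0 : 0 < r.
Hypothesis r1 : r < 1.
Hypothesis I1 : (1 < #|I|)%N.
Local Notation dN := (bowen (@linf_dist R) (@linf_shift R) N).
Hypothesis Xx : forall i, X (x i).
Hypothesis piece : forall i, exists b,
  (exists2 y, X y & x i = r *: y + b) /\ forall z, X z -> X (r *: z + b).
Hypothesis x_separated : forall i j, i != j ->
  4 * (1 + (B + B)) * r <= dN (x i) (x j).

(* Separated points of [X] lie in disjoint copies of [X] scaled by [r], so [X]
   contains a Cantor set coded by infinite words over [I]. *)
Lemma separated_coding : exists q : (nat -> I) -> linf R,
  (forall w, X (q w)) /\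
  forall l w w', (forall k, (k < l)%N -> w k = w' k) -> w l != w' l ->
    2 * r ^+ l.+1 <= dN (q w) (q w').
Proof.
have /card_gt0P[i0 _] := ltnW I1.
have B0 : 0 <= B := le_trans (normr_ge0 _) (XB 0%N (Xx i0)).
have dB y z : X y -> X z -> dN y z <= B + B.
  by move=> Xy Xz; apply: bowen_linf_le => n; exact: XB.
have /choice[b bP] := piece.
have [q qP] := @coding_map _ _ X B r b (ex_intro _ _ (Xx i0)) Xc XB (ltW r0) r1
  (fun i => (bP i).2).
have [_ dC dT] := @bowen_linf_pseudometric R N.
exists q; split => [w|l]; first by have [] := qP w.
elim: l => [|l IH] w w' ww' wl.
  (* Coded points lie within 2 B r of the centre of their first letter, so a separation of 4 r + 8 B
     r leaves at least 4 r + 4 B r when first letters differ. *)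
  have close v : dN (x (v 0%N)) (q v) <= r * (B + B).
    have [[y Xy ->] _] := bP (v 0%N); rewrite (qP v).2.
    rewrite (bowen_linf_scaleD _ _ _ _ (ltW r0)) ler_pM2l//.
    by apply: dB => //; exact: (qP _).1.
  have := close w; have := close w'; have := x_separated wl.
  have := dT (x (w 0%N)) (q w) (x (w' 0%N)).
  have := dT (q w) (q w') (x (w' 0%N)); rewrite (dC (q w') (x (w' 0%N))) expr1.
  have := mulr_ge0 (ltW r0) B0; have := r0.
  rewrite (_ : 4 * _ * r = 4 * r + 8 * (r * B)); last by ring.
  by rewrite (_ : r * (B + B) = 2 * (r * B)); [lra|ring].
rewrite (qP w).2 (qP w').2 ww'// (bowen_linf_scaleD _ _ _ _ (ltW r0)).
by rewrite exprS mulrCA ler_pM2l// IH// => k kl; exact: ww'.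
Qed.

Let M_gt0 : 0 < #|I|%:R :> R.
Proof. by rewrite ltr0n ltnW. Qed.

Lemma exists_small_inv_pow (eta : R) : 0 < eta ->
  exists l, #|I|%:R ^- l <= eta.
Proof.
move=> eta0; have cvg0 : (fun k => (#|I|%:R^-1 : R) ^+ k) @ \oo --> 0.
  by apply: cvg_expr; rewrite gtr0_norm ?invr_gt0// invf_lt1// ltr1n.
have /cvgrPdist_le/(_ eta eta0)[l _ /(_ l (leqnn l))] := cvg0.
rewrite /= sub0r normrN exprVn => h; exists l.
exact: le_trans (ler_norm _) h.
Qed.

(** Each set of a cover is traded for a cylinder of measure at most its diameter to the power [t],
    up to a summable error. The length [l] must be short enough for diameter [rho] to determine [l]
    letters, and long enough for the measure bound. *)
Lemma hausdorff_content_ge1 (t delta : R) : 0 < t -> 0 < delta ->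
  (forall rho, 0 < rho -> rho < delta ->
     exists l, rho <= r ^+ l /\ #|I|%:R ^- l <= rho `^ t) ->
  (1 <= hausdorff_content dN X delta t)%E.
Proof.
move=> t0 delta0 tP; have [q [Xq qsep]] := separated_coding.
apply: hausdorff_content_ge => E XE Edelta.
apply/lee_addgt0Pr => eta eta0.
have /card_gt0P[i0 _] := ltnW I1.
have word n : exists v : seq I,
    ((#|I|%:R ^- size v)%:E <= diam_pow dN t (E n) + (eta / (2 ^ n.+1)%:R)%:E)%E
    /\ forall w, E n (q w) -> v = mkseq w (size v).
  have etan : 0 < eta / (2 ^ n.+1)%:R by rewrite divr_gt0// ltr0n expn_gt0.
  (* Length [L] serves the sets without coded points and those of diameter 0, where the error term
     alone pays for the cylinder. *)
  have [L Lle] := exists_small_inv_pow etan.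
  have [[w0 Ew0]|/forallNP noE] := pselect (exists w, E n (q w)); last first.
    exists (nseq L i0); rewrite size_nseq; split; last by move=> w /noE.
    by rewrite -[leLHS]add0e leeD ?diam_pow_ge0// lee_fin.
  have En0 : (E n == set0) = false.
    by apply/negbTE/set0P; exists (q w0).
  rewrite /diam_pow En0.
  have [rho [rho0 rhod dE]] := diam_lt delta0 (@bowen_linf_pseudometric R N) (Edelta n).
  (* A first disagreement at j < l would put the points at distance at least 2 r^(j+1), which
     exceeds r^l and hence [rho]. *)
  have common l : rho <= r ^+ l -> forall w, E n (q w) -> mkseq w0 l = mkseq w l.
    move=> rhol w Ew; apply/eq_in_map => k; rewrite mem_iota add0n => /andP[_ kl].
    apply: contrapT => /eqP w0w.
    have ex : exists k, w0 k != w k by exists k.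
    case: (ex_minnP ex) => j j_ne jmin.
    have jk := jmin _ w0w.
    have agree i : (i < j)%N -> w0 i = w i.
      by move=> ij; apply: contrapT => /eqP/jmin; rewrite leqNgt ij.
    have := qsep j w0 w agree j_ne.
    have : dN (q w0) (q w) <= rho.
      by apply: ((diam_leP dN (E n) rho0).1 _ _ _ Ew0 Ew); rewrite dE.
    have : r ^+ l <= r ^+ j.+1.
      by rewrite ler_wiXn2l ?ltW// (leq_ltn_trans jk).
    by have := exprn_gt0 j.+1 r0; lra.
  have [rhoE|rho_neq0] := eqVneq rho 0.
    exists (mkseq w0 L); rewrite size_mkseq; split.
      by rewrite -[leLHS]add0e leeD ?poweR_ge0// lee_fin.
    by apply: common; rewrite rhoE exprn_ge0// ltW.
  have rho_gt0 : 0 < rho by rewrite lt_neqAle eq_sym rho_neq0.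
  have [l [rhol Ml]] := tP rho rho_gt0 rhod.
  exists (mkseq w0 l); rewrite size_mkseq; split; last exact: common.
  rewrite dE poweR_EFin -EFinD lee_fin (le_trans Ml)// lerDl ltW//.
have /choice[v vP] := word.
have vcover w : exists n, v n = mkseq w (size (v n)).
  have : X (q w) by [].
  by rewrite XE => -[n _ Enw]; exists n; exact: (vP n).2.
apply: (le_trans (@prefix_cover_sum_ge1 R I i0 v vcover)).
apply: le_trans (epsilon_trick _ _ (ltW eta0)); last first.
  by move=> n; exact: diam_pow_ge0.
apply: lee_nneseries => [n _ _|n _]; last exact: (vP n).1.
by rewrite lee_fin invr_ge0 exprn_ge0// ltW.
Qed.

End HausdorffLowerBound.

(** * From scale entropy to the lower mean Hausdorff dimension *)

Section PackingBound.
Context {R : realType}.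
Variables (X : set (linf R)) (B c : R).
Local Notation d := (@linf_dist R).
Local Notation sh := (@linf_shift R).
Hypothesis X0 : X !=set0.
Hypothesis Xc : compact X.
Hypothesis XB : forall x n, X x -> `|x n| <= B.
Hypothesis c0 : 0 < c.
Hypothesis c1 : c < 1.
Hypothesis shX : forall x, X x -> X (sh x).
Hypothesis Xtb : forall e : R, 0 < e -> exists I : finType, coloring d X e I.
Hypothesis piece : forall m x, X x -> exists b,
  (exists2 y, X y & x = c ^+ m *: y + b) /\ forall z, X z -> X (c ^+ m *: z + b).

(** The factor 3 is lost in passing to separated sets; the rest is the separation that the coding
    with ratio [c ^+ m] requires. *)
Let H m := scale_entropy d sh X (3 * (4 * (1 + (B + B)) * c ^+ m)).

Let scale_gt0 m : 0 < 4 * (1 + (B + B)) * c ^+ m.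
Proof.
have [x Xx] := X0; have := le_trans (normr_ge0 _) (XB 0%N Xx) => B0.
by rewrite mulr_gt0 ?exprn_gt0//; lra.
Qed.

(** The ideal exponent per unit of time is [s2]. Diameters fall between consecutive powers of the
    ratio, and the smaller [s1] absorbs this rounding as soon as word lengths reach [l0]. *)
Lemma le_dimH_scale m N (s1 s2 : R) l0 : (0 < m)%N -> (0 < N)%N ->
  0 < s1 -> s1 <= s2 -> s1 * l0.+1%:R <= s2 * l0%:R ->
  s2 * (m%:R * ln c^-1) = H m ->
  ((N%:R * s1)%:E <= dimH (bowen d sh N) X ((c ^+ m) ^+ l0))%E.
Proof.
move=> m0 N0 s10 s12 s1l0 s2H; set r := c ^+ m.
have r0 : 0 < r by exact: exprn_gt0.
have r1 : r < 1 by rewrite exprn_ilt1 ?ltW// -?lt0n// gt_eqF.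
have lam0 : 0 < ln c^-1 by rewrite ln_gt0// invf_gt1.
have mR : 0 < m%:R :> R by rewrite ltr0n.
have NR : 0 < N%:R :> R by rewrite ltr0n.
have Hgt0 : 0 < H m.
  by rewrite -s2H mulr_gt0 ?mulr_gt0// (lt_le_trans s10).
have e30 : 0 < 3 * (4 * (1 + (B + B)) * r) by rewrite mulr_gt0 ?scale_gt0.
have dNP := @bowen_linf_pseudometric R N.
have [I cI] := Xtb (scale_gt0 m); have [J cJ] := coloring_bowen shX N (scale_gt0 m) cI.
have [n [x [Xx sepx Kn]]] := maximal_separated dNP (scale_gt0 m) X0 cJ.
have lnn : H m * N%:R <= ln n%:R.
  have [_ /(_ N) HN _] := scale_entropyP (@linf_dist_pseudometric R) shX X0 Xtb e30.
  apply: (le_trans HN).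
  have K0 := bowen_covering_number_gt0 (@linf_dist_pseudometric R) shX X0 Xtb N e30.
  by rewrite ler_ln ?posrE ?ltr0n ?(leq_trans K0)// ler_nat.
have n1 : (1 < n)%N.
  rewrite ltnNge; apply/negP => n1; have := mulr_gt0 Hgt0 NR.
  rewrite ltNge (le_trans lnn)//; apply: ln_le0.
  by rewrite -[1]/(1%:R) ler_nat.
have n0 := ltnW n1.
apply: dimH_ge; first by rewrite mulr_ge0 ?ltW.
apply: (@hausdorff_content_ge1 _ X B r N 'I_n x) => //.
- by rewrite card_ord.
- by move=> i; exact: piece.
- by rewrite mulr_gt0.
- exact: exprn_gt0.
rewrite card_ord => rho rho0 rhol0.
(* The least such exponent is written [l.+1]; it is positive because rho < r^l0 <= 1. *)
have ex : exists k, r ^+ k <= rho.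
  have cvg0 : (fun k => r ^+ k) @ \oo --> 0 by apply: cvg_expr; rewrite gtr0_norm.
  have /cvgrPdist_le/(_ rho rho0)[k _ /(_ k (leqnn k))] := cvg0.
  rewrite /= sub0r normrN => h; exists k; exact: le_trans (ler_norm _) h.
case: (ex_minnP ex) => -[|l] rl lmin.
  have : r ^+ l0 <= 1 by rewrite exprn_ile1 ?ltW.
  by move: rl; rewrite expr0; lra.
have rhol : rho <= r ^+ l.
  by rewrite ltW// ltNge; apply/negP => /lmin; rewrite ltnn.
have l0l : (l0 <= l)%N.
  rewrite -ltnS ltnNge; apply/negP => ll0.
  have : r ^+ l0 <= r ^+ l.+1 by rewrite ler_wiXn2l ?ltW.
  by lra.
exists l; split => //.
rewrite -ler_ln ?posrE ?powR_gt0 ?invr_gt0 ?exprn_gt0 ?ltr0n//.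
rewrite ln_powR lnV ?posrE ?exprn_gt0 ?ltr0n// lnXn ?ltr0n//.
have lnrho : - (l.+1%:R * (m%:R * ln c^-1)) <= ln rho.
  have : ln (r ^+ l.+1) <= ln rho by rewrite ler_ln ?posrE ?exprn_gt0.
  rewrite lnXn// /r lnXn// lnV ?posrE// -mulr_natl -[ln c *+ m]mulr_natl; lra.
have s1l : s1 * l.+1%:R <= s2 * l%:R.
  rewrite -(subnK l0l) -addnS !natrD !mulrDr.
  by rewrite lerD// ler_wpM2r.
have step1 : N%:R * s1 * - (l.+1%:R * (m%:R * ln c^-1)) <= N%:R * s1 * ln rho.
  by rewrite ler_wpM2l// mulr_ge0 ?ltW.
apply: le_trans step1; rewrite -[ln n%:R *+ l]mulr_natl mulrN lerN2.
apply: (@le_trans _ _ (l%:R * (H m * N%:R))); last by rewrite ler_wpM2l.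
rewrite -s2H [leLHS](_ : _ = (s1 * l.+1%:R) * (N%:R * (m%:R * ln c^-1))); last by ring.
rewrite [leRHS](_ : _ = (s2 * l%:R) * (N%:R * (m%:R * ln c^-1))); last by ring.
by rewrite ler_wpM2r// mulr_ge0 ?mulr_ge0 ?ltW.
Qed.

Lemma scale_entropy_le_lower_mdimH m (v : R) : (0 < m)%N ->
  lower_mdimH d sh X = v%:E -> H m <= v * (m%:R * ln c^-1).
Proof.
move=> m0 vE; have lam0 : 0 < ln c^-1 by rewrite ln_gt0// invf_gt1.
have mlam0 : 0 < m%:R * ln c^-1 by rewrite mulr_gt0// ltr0n.
have v0 : 0 <= v by rewrite -lee_fin -vE; exact: lower_mdimH_ge0.
rewrite -ler_pdivrMr//; set s2 := H m / _; rewrite leNgt; apply/negP => vs2.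
(* Any exponent strictly between [v] and [s2] would be a lower bound for [v], a contradiction. *)
pose s1 := (v + s2) / 2.
have s1s2 : s1 < s2 by rewrite /s1; lra.
have s10 : 0 < s1 by rewrite /s1; lra.
have [l0 Hl0] : exists l0 : nat, s1 * l0.+1%:R <= s2 * l0%:R.
  exists (Num.bound (s1 / (s2 - s1))); set k := Num.bound _.
  have : s1 / (s2 - s1) < k%:R.
    by apply: archi_boundP; rewrite divr_ge0 ?subr_ge0 ?ltW.
  by rewrite ltr_pdivrMr ?subr_gt0// -natr1; lra.
have : (s1%:E <= lower_mdimH d sh X)%E.
  apply: (@le_lower_mdimH _ _ _ _ _ s1 ((c ^+ m) ^+ l0)) => [|N N0].
    by rewrite !exprn_gt0.
  apply: le_dimH_scale Hl0 _ => //; first exact: ltW.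
  by rewrite /s2 divfK// gt_eqF.
by rewrite vE lee_fin /s1; lra.
Qed.

(** Take the least [m] with K c^m <= e: it is positive as e < K, and minimality gives e < K
    c^(m-1). *)
Lemma exists_scale (e K : R) : 0 < e -> e < K ->
  exists m : nat, [/\ (0 < m)%N, K * c ^+ m <= e
    & m%:R * ln c^-1 <= ln e^-1 + (ln K + ln c^-1)].
Proof.
move=> e0 eK; have K0 := lt_trans e0 eK.
have lam0 : 0 < ln c^-1 by rewrite ln_gt0// invf_gt1.
have ex : exists k, K * c ^+ k <= e.
  have cvg0 : (fun k => c ^+ k) @ \oo --> 0 by apply: cvg_expr; rewrite gtr0_norm.
  have /cvgrPdist_le/(_ (e / K) (divr_gt0 e0 K0))[k _ /(_ k (leqnn k))] := cvg0.
  rewrite /= sub0r normrN => h; exists k; rewrite mulrC -ler_pdivlMr//.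
  exact: le_trans (ler_norm _) h.
case: (ex_minnP ex) => -[|m] Km mmin; first by move: Km; rewrite expr0; lra.
exists m.+1; split => //.
have : e < K * c ^+ m by rewrite ltNge; apply/negP => /mmin; rewrite ltnn.
rewrite -ltr_ln ?posrE ?mulr_gt0 ?exprn_gt0//.
rewrite lnM ?posrE ?exprn_gt0// lnXn// !lnV ?posrE// -mulr_natl -natr1; lra.
Qed.

(** A scale [e] is compared with the nearest scale K c^m below it; the bounded loss in [m * ln c^-1]
    vanishes after division by [ln e^-1]. *)
Lemma upper_mdimM_le_lower_mdimH : (upper_mdimM d sh X <= lower_mdimH d sh X)%E.
Proof.
have := lower_mdimH_ge0 d sh X0.
case vE : (lower_mdimH d sh X) => [v| |] // v0; last by rewrite leey.
have lam0 : 0 < ln c^-1 by rewrite ln_gt0// invf_gt1.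
pose K := 3 * (4 * (1 + (B + B))).
have K1 : 1 <= K.
  have [x Xx] := X0; have := le_trans (normr_ge0 _) (XB 0%N Xx); rewrite /K; lra.
have lnK : 0 <= ln K by exact: ln_ge0.
apply: (@upper_mdimM_log_le _ _ _ _ _ (@linf_dist_pseudometric R) shX X0 Xtb
  v (ln K + ln c^-1) 1) => // [|e /andP[e0 e1]]; first lra.
have [m [m0 Km mle]] := exists_scale e0 (lt_le_trans e1 K1).
apply: (@le_trans _ _ (H m)).
  apply: (le_scale_entropy (@linf_dist_pseudometric R)) => //.
    by rewrite mulr_gt0 ?scale_gt0.
  by move: Km; rewrite /K !mulrA.
by rewrite (le_trans (scale_entropy_le_lower_mdimH m0 vE))// ler_wpM2l.
Qed.

End PackingBound.

(** * Finite nets and uniform continuity on the base space *)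

Section CompactMetric.
Context {R : realType} {Omega : metricType R}.
Hypothesis Omega_compact : compact [set: Omega].

Lemma mdist_pseudometric : pseudometric (@mdist R Omega).
Proof.
by split; [exact: mdistxx|exact: metric_sym|exact: metric_triangle].
Qed.

(* Finite subcovers come from [near_covering] for the filter of all large enough
   finite sets of centres: [compact_cover] is stated for pointed spaces only. *)
Lemma compact_finite_net (e : R) : 0 < e ->
  exists s : seq Omega, forall w, exists2 x, x \in s & mdist x w < e.
Proof.
move=> e0.
pose F : set_system (seq Omega) :=
  [set U : set (seq Omega) | exists s0 : seq Omega, forall s, {subset s0 <= s} -> U s].
have FF : Filter F.
  split; first by exists [::].
  - move=> U V [s sU] [t tV]; exists (s ++ t) => u stu; split.
      by apply: sU => x xs; apply: stu; rewrite mem_cat xs.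
    by apply: tV => x xt; apply: stu; rewrite mem_cat xt orbT.
  - by move=> U V UV [s sU]; exists s => t /sU; exact: UV.
pose P (s : seq Omega) w := exists2 x, x \in s & mdist x w < e.
have near_w w : [set: Omega] w -> \near w & F, P F w.
  move=> _; exists (ball w e, [set s : seq Omega | w \in s]); first split => /=.
  - exact: nbhsx_ballx.
  - by exists [:: w] => s; apply; rewrite mem_head.
  - by move=> [w' s] /= [ww' ws]; exists w => //; move: ww'; rewrite ballEmdist.
have [s sP] := (compact_near_coveringP _).1 Omega_compact _ F P FF near_w.
by exists s => w; exact: (sP s).
Qed.

Lemma compact_coloring (e : R) : 0 < e ->
  exists I : finType, coloring (@mdist R Omega) setT e I.
Proof.
move=> e0; have e4 : 0 < e / 4 by lra.
have [s sP] := compact_finite_net e4.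
have /choice[col colP] w : exists i : seq_sub s, mdist (ssval i) w < e / 4.
  by have [x xs xw] := sP w; exists (SeqSub xs).
exists (seq_sub s), col, (e / 2); split; first lra.
move=> x y _ _ xy; have := colP x; have := colP y; rewrite -xy.
have := metric_triangle x (ssval (col x)) y.
by rewrite (metric_sym x (ssval (col x))); lra.
Qed.

(** Near each point every small enough [delta] works; compactness makes the choice uniform, along
    the filter of positive [delta] tending to 0. *)
Lemma uniformly_continuous_mdist (g : Omega -> R) (eta : R) : continuous g ->
  0 < eta -> exists2 delta : R, 0 < delta &
    forall w w', mdist w w' < delta -> `|g w - g w'| <= eta.
Proof.
move=> gc eta0.
pose P (delta : R) (w : Omega) := forall w', mdist w w' < delta ->
  `|g w - g w'| <= eta.
pose F : set_system R := (0 : R)^'+.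
have near_w w : [set: Omega] w -> \near w & F, P F w.
  move=> _; have /cvgrPdist_lt/(_ (eta / 2)) := gc w.
  move=> /(_ (divr_gt0 eta0 (ltr0Sn _ 1))) /nbhs_ballP[e /= e0 eP].
  have e2 : 0 < e / 2 by rewrite divr_gt0.
  exists (ball w (e / 2), [set delta | 0 < delta < e / 2]).
    by split => /=; [exact: nbhsx_ballx|exact: near0_right].
  move=> [w1 delta] /= [ww1 /andP[_ de]] w2 w12.
  move: ww1; rewrite ballEmdist /= => ww1.
  have h1 : `|g w - g w1| < eta / 2.
    by apply: eP; rewrite ballEmdist /=; lra.
  have h2 : `|g w - g w2| < eta / 2.
    apply: eP; rewrite ballEmdist /=; have := metric_triangle w w1 w2; lra.
  have := ler_normB (g w - g w2) (g w - g w1).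
  rewrite [g w - g w2 - _](_ : _ = g w1 - g w2); last lra.
  lra.
have dP := (compact_near_coveringP _).1 Omega_compact _ F P (at_right_proper_filter _) near_w.
have [delta [delta0 dPd]] := filter_ex (filterI (nbhs_right_gt (0 : R)) dP).
by exists delta => // w w'; exact: dPd.
Qed.

End CompactMetric.

(** * The entropy bound *)

Section Entropy.
Context {R : realType} {Omega : metricType R}.
Variables (T : Omega -> Omega) (a : Omega -> linf R) (c : R) (X : set (linf R)).
Hypothesis Omega_nonempty : [set: Omega] !=set0.
Hypothesis Omega_compact : compact [set: Omega].
Hypothesis a_continuous : continuous a.
Hypothesis a_equivariant : forall w, linf_shift (a w) = a (T w).
Hypothesis c_gt0 : 0 < c.
Hypothesis c_lt1 : c < 1.
Hypothesis X_self_similar :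
  self_similar_system (fun w (x : linf R) => c *: x + a w) X.
Local Notation d := (@linf_dist R).
Local Notation sh := (@linf_shift R).
Local Notation dO := (@mdist R Omega).

Lemma coords_uniformly_continuous L (eta : R) : 0 < eta ->
  exists2 delta : R, 0 < delta & forall n w w', (n < L)%N -> mdist w w' < delta ->
    `|a w n - a w' n| <= eta.
Proof.
move=> eta0; elim: L => [|L [delta delta0 IH]]; first by exists 1.
have [delta' delta'0 h] := uniformly_continuous_mdist Omega_compact
  (coord_map_continuous a_continuous (n := L)) eta0.
exists (Num.min delta delta'); first by rewrite lt_min delta0.
move=> n w w'; rewrite ltnS leq_eqVlt lt_min => /orP[/eqP -> /andP[_]|nL /andP[+ _]].
  exact: h.
exact: IH.
Qed.

(** The first [L] coordinates are uniformly continuous, and the uniform bound on [a] makes the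
    weighted tail small. *)
Lemma translation_uniformly_continuous (eta : R) : 0 < eta ->
  exists2 delta : R, 0 < delta &
    forall w w', mdist w w' < delta -> d (a w) (a w') <= eta.
Proof.
move=> eta0; have [A AP] := translation_bounded Omega_compact a_continuous a_equivariant.
have [w0 _] := Omega_nonempty; have A0 := le_trans (normr_ge0 _) (AP w0 0%N).
have [L HL] : exists L, (A + A) * 2 ^- L <= eta / 2.
  have cvg0 : (fun k => (A + A) * (2^-1 : R) ^+ k) @ \oo --> 0.
    rewrite -[X in _ --> X](mulr0 (A + A)); apply: cvgMr; apply: cvg_expr.
    by rewrite ger0_norm//; lra.
  have e2 : 0 < eta / 2 by lra.
  have /cvgrPdist_le/(_ _ e2)[k _ /(_ k (leqnn k))] := cvg0.
  rewrite /= sub0r normrN exprVn => h; exists k.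
  exact: le_trans (ler_norm _) h.
have e2 : 0 < eta / 2 by lra.
have [delta delta0 dP] := coords_uniformly_continuous L e2.
exists delta => // w w' ww'; apply: (@le_trans _ _ (eta / 2 + (A + A) * 2 ^- L)).
  apply: linf_dist_le => [||n nL|n]; [lra|exact: addr_ge0|exact: dP|].
  by rewrite (le_trans (ler_normB _ _))// lerD.
by lra.
Qed.

(* [x = a(w_1) + ... + c^(n-1) a(w_n) + c^n y] is coloured by the colours of the
   [w_i]. *)
Lemma coloring_self_similar (B eta delta : R) N n (J : finType) : 0 <= eta ->
  (forall x n, X x -> `|x n| <= B) ->
  (forall w w', mdist w w' < delta -> d (a w) (a w') <= eta) ->
  coloring (bowen dO T N) setT delta J ->
  exists2 K : finType, #|K| = (#|J| ^ n)%N & exists f : linf R -> K,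
    forall x y, X x -> X y -> f x = f y ->
      bowen d sh N x y <= eta / (1 - c) + c ^+ n * (B + B).
Proof.
move=> eta0 XB adelta [col [r [rdelta colP]]].
have ac w w' : col w = col w' -> bowen d sh N (a w) (a w') <= eta.
  move=> ww'; apply/bowen_leP => // k kN.
  rewrite !(iter_shift_equivariant a_equivariant); apply: adelta.
  by apply: le_lt_trans rdelta; apply: le_trans (colP w w' I I ww'); exact: le_bowen.
have c1 : 0 < 1 - c by rewrite subr_gt0.
elim: n => [|n [K cardK [f fP]]].
  exists unit; first by rewrite card_unit.
  exists (fun=> tt) => x y Xx Xy _; rewrite expr0 mul1r.
  apply: (@le_trans _ _ (B + B)); first by apply: bowen_linf_le => n; exact: XB.
  by rewrite lerDr divr_ge0// ltW.
have [w0 _] := Omega_nonempty.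
have /choice[pre preP] x : exists p : Omega * linf R,
    X x -> X p.2 /\ x = c *: p.2 + a p.1.
  have [/(self_similar_pre X_self_similar)[w [y wy]]|nXx] := pselect (X x).
    by exists (w, y).
  by exists (w0, x).
exists (J * K)%type; first by rewrite card_prod cardK expnS.
exists (fun x => (col (pre x).1, f (pre x).2)) => x y Xx Xy [cxy fxy].
have [Xpx ->] := preP _ Xx; have [Xpy ->] := preP _ Xy.
apply: (le_trans (bowen_linf_scaleD_le _ _ _ _ _ (ltW c_gt0))).
have h1 := ac _ _ cxy; have h2 := fP _ _ Xpx Xpy fxy.
have h3 := ler_wpM2l (ltW c_gt0) h2.
apply: (le_trans (lerD h3 h1)); rewrite exprS mulrDr -mulrA.
(* The value [eta / (1 - c)] is the fixed point of s |-> c s + eta, so the bound reproduces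
   itself. *)
rewrite -addrA [c * (eta / _)](_ : _ = eta / (1 - c) - eta); last by field; lra.
lra.
Qed.

(** The scale [delta] is fixed before [N] and [n], which allows letting [N] tend to infinity at
    fixed scales on both sides. *)
Lemma self_similar_coloring (B e : R) : 0 < e -> (forall x n, X x -> `|x n| <= B) ->
  exists2 delta, 0 < delta & forall N n (J : finType),
    4 * (1 + (B + B)) * c ^+ n <= e ->
    coloring (bowen dO T N) setT delta J ->
    exists2 K : finType, #|K| = (#|J| ^ n)%N & coloring (bowen d sh N) X e K.
Proof.
move=> e0 XB; have c1 : 0 < 1 - c by rewrite subr_gt0.
(* With this [eta] the translations cost [e / 4] in total; the remainder c^n 2B costs at most
   another [e / 4]. *)
have eta0 : 0 < e / 4 * (1 - c) by rewrite mulr_gt0//; lra.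
have [delta delta0 adelta] := translation_uniformly_continuous eta0.
exists delta => // N n J cn cJ.
have [K cardK [f fP]] := coloring_self_similar n (ltW eta0) XB adelta cJ.
exists K => //; exists f, (e / 4 + c ^+ n * (B + B)); split; last first.
  by move=> x y Xx Xy fxy; have := fP x y Xx Xy fxy; rewrite mulfK// gt_eqF.
have : 0 <= c ^+ n by rewrite exprn_ge0// ltW.
by lra.
Qed.

Lemma self_similar_totally_bounded (e : R) : 0 < e ->
  exists I : finType, coloring d X e I.
Proof.
have [B XB] := self_similar_bounded Omega_compact a_continuous a_equivariant
  c_gt0 c_lt1 X_self_similar.
move=> e0; have [delta delta0 h] := self_similar_coloring e0 XB.
have [[x Xx] _ _] := X_self_similar; have B0 := le_trans (normr_ge0 _) (XB x 0%N Xx).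
(* Adding [e] makes the constant exceed [e], as the choice of [n] requires. *)
have K0 : 0 < 4 * (1 + (B + B)) + e by lra.
have [n [_ nle _]] := @exists_scale R c c_gt0 c_lt1 e (4 * (1 + (B + B)) + e) e0
  (ltac:(lra)).
have [J cJ] := compact_coloring Omega_compact delta0.
have [J' cJ'] := coloring_bowen (f := T) (fun x _ => Logic.I) 1 delta0 cJ.
have [|K _ [f [r [re fP]]]] := h 1%N n J' _ cJ'.
  apply: le_trans nle; rewrite ler_wpM2r ?exprn_ge0 ?ltW//; lra.
exists K, f, r; split => // y z Xy Xz fyz; apply: le_trans (fP _ _ Xy Xz fyz).
exact: (@le_bowen _ _ d sh 1 y z 0%N).
Qed.

(** For every [N] the covering number of [X] at scale [e] is at most the [m]-th power of that of the
    base at scale [delta]. Hence the scale entropy at [e] is at most [m] times the entropy, with [m]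
    about ln(1/e) / ln(1/c). *)
Lemma upper_mdimM_le_htop :
  (upper_mdimM d sh X <= htop dO T setT * ((ln c^-1)^-1)%:E)%E.
Proof.
have lam0 : 0 < ln c^-1 by rewrite ln_gt0// invf_gt1.
have [B XB] := self_similar_bounded Omega_compact a_continuous a_equivariant
  c_gt0 c_lt1 X_self_similar.
have [X0 _ _] := X_self_similar.
have B0 : 0 <= B by have [x Xx] := X0; exact: le_trans (normr_ge0 _) (XB x 0%N Xx).
have shX := self_similar_shift Omega_compact a_continuous a_equivariant
  c_gt0 c_lt1 X_self_similar.
have dP := @linf_dist_pseudometric R; have dOP := @mdist_pseudometric R Omega.
have TT (x : Omega) : setT x -> setT (T x) by [].
have Otb := compact_coloring Omega_compact.
have Hle := scale_entropy_le_htop dOP TT Omega_nonempty Otb.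
have H1 := Hle 1 ltr01.
have [H10 _ _] := scale_entropyP dOP TT Omega_nonempty Otb ltr01.
case hE : (htop dO T setT) => [h| |]; first last.
- by move: H1; rewrite hE leeNy_eq.
- by rewrite gt0_mulye ?leey// lte_fin invr_gt0.
have h0 : 0 <= h by apply: le_trans H10 _; rewrite -lee_fin -hE.
pose K := 4 * (1 + (B + B)).
have K1 : 1 <= K by rewrite /K; lra.
have lnK : 0 <= ln K by exact: ln_ge0.
rewrite -EFinM.
apply: (@upper_mdimM_log_le _ _ _ _ _ dP shX X0 self_similar_totally_bounded
  (h / ln c^-1) (ln K + ln c^-1) 1) => //; first by rewrite divr_ge0// ltW.
  by rewrite addr_ge0// ltW.
move=> e /andP[e0 e1].
have [m [m0 Km mle]] := exists_scale c_gt0 c_lt1 e0 (lt_le_trans e1 K1).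
have [delta delta0 col] := self_similar_coloring e0 XB.
apply: (@le_trans _ _ (m%:R * scale_entropy dO T setT delta)).
  have [_ _ cX] := scale_entropyP dP shX X0 self_similar_totally_bounded e0.
  have [_ _ cO] := scale_entropyP dOP TT Omega_nonempty Otb delta0.
  apply: (ler_cvg_to cX (cvgMr (a := m%:R) cO)).
  apply: nearW => N; rewrite mulrA ler_wpM2r ?invr_ge0//.
  have KO := bowen_covering_number_gt0 dOP TT Omega_nonempty Otb N delta0.
  have KX := bowen_covering_number_gt0 dP shX X0 self_similar_totally_bounded N e0.
  have [J cJ] := Otb _ delta0.
  have [J' /(covering_number_coloring (pseudometric_bowen T N dOP) delta0 Omega_nonempty)
    cJ'] := coloring_bowen TT N delta0 cJ.
  have [L cardL /(covering_number_le (pseudometric_bowen sh N dP) e0)] :=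
    col N m _ Km cJ'.
  rewrite cardL card_ord mulr_natl -lnXn ?ltr0n// => KK.
  by rewrite ler_ln ?posrE ?exprn_gt0 ?ltr0n// -natrX ler_nat.
have Hd : scale_entropy dO T setT delta <= h by rewrite -lee_fin -hE Hle.
apply: (@le_trans _ _ (m%:R * h)); first by rewrite ler_wpM2l.
rewrite (_ : m%:R * h = h / ln c^-1 * (m%:R * ln c^-1)); last first.
  by field; rewrite gt_eqF.
by rewrite ler_wpM2l// divr_ge0// ltW.
Qed.

End Entropy.

(** * Equality of the mean dimensions and the entropy bound *)

Theorem theorem4p3 (R : realType) (Omega : metricType R) (T : Omega -> Omega)
    (a : Omega -> linf R) (c : R) (X : set (linf R))
    (Omega_nonempty : [set: Omega] !=set0)
    (Omega_compact : compact [set: Omega])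
    (T_continuous : continuous T)
    (a_continuous : continuous a)
    (a_equivariant : forall w, linf_shift (a w) = a (T w))
    (c_gt0 : 0 < c) (c_lt1 : c < 1)
    (X_self_similar :
       self_similar_system (fun w (x : linf R) => c *: x + a w) X) :
  exists v : \bar R,
    [/\ is_mdimH (@linf_dist R) (@linf_shift R) X v,
        is_mdimM (@linf_dist R) (@linf_shift R) X v
      & (v <= htop (@mdist R Omega) T [set: Omega] * ((ln c^-1)^-1)%:E)%E].
Proof.
have [X0 Xc _] := X_self_similar.
have [B XB] := self_similar_bounded Omega_compact a_continuous a_equivariant
  c_gt0 c_lt1 X_self_similar.
have shX := self_similar_shift Omega_compact a_continuous a_equivariant
  c_gt0 c_lt1 X_self_similar.
have Xtb := self_similar_totally_bounded Omega_nonempty Omega_compact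
  a_continuous a_equivariant c_gt0 c_lt1 X_self_similar.
have piece := self_similar_piece X_self_similar.
have [HX [upM lowM]] := mean_dimensions_eq (@linf_dist_pseudometric R) shX X0 Xtb
  (upper_mdimM_le_lower_mdimH X0 Xc XB c_gt0 c_lt1 shX Xtb piece).
(* The common value equals the upper metric mean dimension, to which the entropy bound applies. *)
exists (lower_mdimH (@linf_dist R) (@linf_shift R) X); split => //.
rewrite -upM; exact: upper_mdimM_le_htop Omega_nonempty Omega_compact
  a_continuous a_equivariant c_gt0 c_lt1 X_self_similar.
Qed.
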